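(* Let $n > 2k \geq 4$ be integers. Let $h(n,k)$ denote the maximum of $|\mathcal F| + |\mathcal G|$ over all pairs of non-trivial cross-intersecting families $\mathcal F, \mathcal G \subset \binom{[n]}{k}$. Then $$h(n,k) = 2 + \binom{n}{k} - 2\binom{n-k}{k} + \binom{n-2k}{k}.$$ Moreover, for $k \geq 3$, up to a permutation of $[n]$ and interchanging the roles of $\mathcal F$ and $\mathcal G$, the only pair attaining this maximum is $\mathcal A = \{A_1, A_2\}$, $\mathcal B = \{B \in \binom{[n]}{k} : B \cap A_1 \neq \emptyset \text{ and } B \cap A_2 \neq \emptyset\}$, where $A_1, A_2 \in \binom{[n]}{k}$ are disjoint.
   Context: $[n] = \{1,\dots,n\}$ and $\binom{[n]}{k}$ is the collection of all $k$-element subsets of $[n]$. Two families $\mathcal F, \mathcal G$ are cross-intersecting if $F \cap G \neq \emptyset$ for all $F \in \mathcal F$, $G \in \mathcal G$. A (non-empty) family $\mathcal F$ is non-trivial if $\bigcap_{F \in \mathcal F} F = \emptyset$. *)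

(* Defs.v *)
From mathcomp Require Import all_boot all_order all_algebra.
Set Implicit Arguments. Unset Strict Implicit. Unset Printing Implicit Defensive.

(* A family of subsets of [n] = 'I_n (elements 0..n-1 model 1..n). *)
Definition uniform_family (n k : nat) (F : {set {set 'I_n}}) : Prop :=
  forall A, A \in F -> #|A| = k.

Definition cross_intersecting (n : nat) (F G : {set {set 'I_n}}) : Prop :=
  forall A B, A \in F -> B \in G -> A :&: B != set0.

Definition nontrivial (n : nat) (F : {set {set 'I_n}}) : Prop :=
  F != set0 /\ \bigcap_(A in F) A = set0.

Definition admissible_pair (n k : nat) (F G : {set {set 'I_n}}) : Prop :=
  [/\ uniform_family k F, uniform_family k G, nontrivial F, nontrivial G
    & cross_intersecting F G].

Definition h_formula (n k : nat) : int :=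
  (2 + 'C(n, k)%:Z - 2 * 'C(n - k, k)%:Z + 'C(n - 2 * k, k)%:Z)%R.

Definition both_meeting (n k : nat) (A1 A2 : {set 'I_n}) : {set {set 'I_n}} :=
  [set B : {set 'I_n} | [&& #|B| == k, B :&: A1 != set0 & B :&: A2 != set0]].

(* Main.v *)
Require Import Defs.
From mathcomp Require Import all_boot all_order all_algebra zify.
Set Implicit Arguments. Unset Strict Implicit. Unset Printing Implicit Defensive.

(* Fix a (k+1)-set K and, among the admissible pairs (F, G) of maximal total
   size, take one maximising the sum of |A :&: K| over the members of both
   families.  Then every compression replacing an element outside K by an
   element of K either fixes both families or makes one of them trivial.

   If all compressions fix F and G, both families contain all k-subsets of K,
   so each member has at least two elements in K.  Double counting between the
   strata |A :&: K| = t and |A :&: K| = k + 1 - t then bounds the sum.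

   Otherwise, say, every member of F meets a pair {x, y}, and x |: X and y |: X
   never both belong to F when X avoids x and y.  Write Fx, Fy, Fxy, F0 for the
   traces on the complement of {x, y} of the members containing x only, y only,
   both or none.  Maximality makes Gx and Gy non-empty, so (Fx, Gy) and (Fy, Gx)
   obey the Hilton-Milner bound.  For T1 in Fx and T2 in Fy, the sets of Fxy are
   matched into the transversals of T1, T2 (and of further members of F) that
   are missing from G0, which bounds |Fxy| + |G0|.  Equality for k >= 3 forces
   Fx = {T1}, Fy = {T2} and Fxy empty, that is |F| = 2. *)

(** * Counting k-subsets *)

Definition draws (T : finType) (Y : {set T}) (k : nat) : {set {set T}} :=
  [set A : {set T} | (A \subset Y) && (#|A| == k)].

Lemma card_draws (T : finType) (Y : {set T}) k : #|draws Y k| = 'C(#|Y|, k).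
Proof. exact: cards_draws. Qed.

Lemma drawsP (T : finType) (Y A : {set T}) k :
  reflect (A \subset Y /\ #|A| = k) (A \in draws Y k).
Proof. by rewrite inE; apply: (iffP andP) => -[sAY /eqP]. Qed.

Lemma disjointsUl (T : finType) (A B C : {set T}) :
  [disjoint A :|: B & C] = [disjoint A & C] && [disjoint B & C].
Proof. by rewrite -!setI_eq0 setIUl setU_eq0. Qed.

Lemma exists_draw (T : finType) (P Y : {set T}) k :
  P \subset Y -> #|P| <= k <= #|Y| -> exists2 A, A \in draws Y k & P \subset A.
Proof.
move=> sPY /andP[lePk lekY].
have : 0 < #|draws (Y :\: P) (k - #|P|)|.
  rewrite card_draws bin_gt0 cardsD (setIidPr sPY); lia.
case/card_gt0P => B /drawsP[sB cB]; exists (P :|: B); last exact: subsetUl.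
apply/drawsP; split; first by rewrite subUset sPY (subset_trans sB) ?subsetDl.
rewrite cardsU cB setIC; have -> : B :&: P = set0.
  by apply/eqP; rewrite setI_eq0; move: sB; rewrite subsetD => /andP[].
rewrite cards0; lia.
Qed.

(* Members of [draws Y k] prescribed to contain [P] and to avoid [V]. *)
Lemma card_draws_between (T : finType) (Y P V : {set T}) k :
  P \subset Y -> [disjoint P & V] -> #|P| <= k ->
  #|[set A in draws Y k | (P \subset A) && [disjoint A & V]]| =
  'C(#|Y :\: V| - #|P|, k - #|P|).
Proof.
move=> sPY dPV lePk.
have -> : #|Y :\: V| - #|P| = #|(Y :\: V) :\: P|.
  by rewrite [RHS]cardsD (setIidPr _) // subsetD sPY.
rewrite -card_draws.
rewrite -[RHS](card_in_imset (f := fun B => P :|: B)); last first.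
  move=> B1 B2 /drawsP[+ _] /drawsP[+ _].
  rewrite !subsetD => /andP[_ d1] /andP[_ d2] /(congr1 (fun X => X :\: P)).
  by rewrite !setDUl setDv !set0U !(setDidPl _).
apply: eq_card => A; rewrite !inE; apply/idP/imsetP.
  case/and3P=> /andP[sAY /eqP cA] sPA dAV; exists (A :\: P); last first.
    by rewrite setDE setUIr setUCr setIT (setUidPr sPA).
  apply/drawsP; split; last by rewrite cardsD (setIidPr sPA) cA.
  by apply: setSD; rewrite subsetD sAY.
case=> B /drawsP[]; rewrite !subsetD => /andP[/andP[sBY dBV] dBP] cB ->.
have dUV : [disjoint P :|: B & V] by rewrite disjointsUl dPV.
rewrite subUset sPY sBY subsetUl dUV /= andbT cardsU cB.
rewrite [P :&: B]setIC (disjoint_setI0 dBP) cards0; lia.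
Qed.

Lemma card_imset_setU (T : finType) (X1 X2 : {set T}) (P1 P2 : {set {set T}}) :
  [disjoint X1 & X2] -> (forall B, B \in P1 -> B \subset X1) ->
  (forall B, B \in P2 -> B \subset X2) ->
  #|[set B1 :|: B2 | B1 in P1, B2 in P2]| = #|P1| * #|P2|.
Proof.
move=> d12 s1 s2; rewrite curry_imset2X card_in_imset ?cardsX //.
have dec (B1 B2 : {set T}) : B1 \subset X1 -> B2 \subset X2 ->
    (B1 :|: B2) :&: X1 = B1 /\ (B1 :|: B2) :&: X2 = B2.
  move=> h1 h2; rewrite !setIUl (setIidPl h1) (setIidPl h2).
  have -> : B2 :&: X1 = set0.
    by apply: disjoint_setI0; rewrite (disjointWl h2) // disjoint_sym.
  have -> : B1 :&: X2 = set0 by apply: disjoint_setI0; rewrite (disjointWl h1).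
  by rewrite setU0 set0U.
move=> [A1 A2] [B1 B2] /setXP[/s1 a1 /s2 a2] /setXP[/s1 b1 /s2 b2] /= e.
have [e1 e2] := dec _ _ a1 a2; have [f1 f2] := dec _ _ b1 b2.
by move: e1 e2; rewrite e f1 f2 => -> ->.
Qed.

Lemma card_draws2 (T : finType) (X1 X2 : {set T}) b1 b2 :
  [disjoint X1 & X2] ->
  #|[set B : {set T} | [&& B \subset X1 :|: X2, #|B :&: X1| == b1
     & #|B :&: X2| == b2]]| = 'C(#|X1|, b1) * 'C(#|X2|, b2).
Proof.
move=> d12; rewrite -!card_draws.
rewrite -(@card_imset_setU _ X1 X2) //; try by move=> B /drawsP[].
apply: eq_card => B; rewrite inE; apply/idP/imset2P.
  case/and3P=> sB c1 c2; exists (B :&: X1) (B :&: X2).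
  - by rewrite inE subsetIr.
  - by rewrite inE subsetIr.
  - by rewrite -setIUr (setIidPl sB).
case=> B1 B2 /drawsP[s1 c1] /drawsP[s2 c2] ->.
rewrite setUSS //= !setIUl (setIidPl s1) (setIidPl s2).
have -> : B2 :&: X1 = set0.
  by apply: disjoint_setI0; rewrite (disjointWl s2) // disjoint_sym.
have -> : B1 :&: X2 = set0 by apply: disjoint_setI0; rewrite (disjointWl s1).
by rewrite setU0 set0U c1 c2 !eqxx.
Qed.

Lemma card_draws3 (T : finType) (X1 X2 X3 : {set T}) b1 b2 b3 :
  [disjoint X1 & X2] -> [disjoint X1 & X3] -> [disjoint X2 & X3] ->
  #|[set B : {set T} | [&& B \subset X1 :|: (X2 :|: X3), #|B :&: X1| == b1,
     #|B :&: X2| == b2 & #|B :&: X3| == b3]]| =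
  'C(#|X1|, b1) * ('C(#|X2|, b2) * 'C(#|X3|, b3)).
Proof.
move=> d12 d13 d23; rewrite -card_draws -(card_draws2 _ _ d23).
have d1 : [disjoint X1 & X2 :|: X3].
  by rewrite disjoint_sym disjointsUl ![[disjoint _ & X1]]disjoint_sym d12.
rewrite -(@card_imset_setU _ X1 (X2 :|: X3)) //; first last.
- by move=> B; rewrite inE => /and3P[].
- by move=> B /drawsP[].
apply: eq_card => B; rewrite inE; apply/idP/imset2P.
  case/and4P=> sB c1 c2 c3; exists (B :&: X1) (B :&: (X2 :|: X3)).
  - by rewrite inE subsetIr.
  - rewrite inE subsetIr /= -!setIA.
    by rewrite (setIidPr (subsetUl X2 X3)) (setIidPr (subsetUr X2 X3)) c2 c3.
  - by rewrite -setIUr (setIidPl sB).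
case=> B1 B2 /drawsP[s1 c1]; rewrite inE => /and3P[s2 c2 c3] ->.
rewrite setUSS //= !setIUl (setIidPl s1).
have -> : B2 :&: X1 = set0.
  by apply: disjoint_setI0; rewrite (disjointWl s2) // disjoint_sym.
have -> : B1 :&: X2 = set0 by apply: disjoint_setI0; rewrite (disjointWl s1).
have -> : B1 :&: X3 = set0 by apply: disjoint_setI0; rewrite (disjointWl s1).
by rewrite setU0 !set0U c1 c2 c3 eqxx.
Qed.

(** Inclusion-exclusion over the draws that miss [T1] or [T2], with the negative terms moved across
    because subtraction of naturals truncates. *)
Lemma card_draws_meeting2 (T : finType) (Y T1 T2 : {set T}) k :
  T1 \subset Y -> T2 \subset Y -> [disjoint T1 & T2] ->
  #|[set E in draws Y k | (E :&: T1 != set0) && (E :&: T2 != set0)]|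
    + 'C(#|Y| - #|T1|, k) + 'C(#|Y| - #|T2|, k) =
  'C(#|Y|, k) + 'C(#|Y| - (#|T1| + #|T2|), k).
Proof.
move=> s1 s2 d12.
have avoid (X : {set T}) : X \subset Y ->
    #|[set E in draws Y k | E :&: X == set0]| = 'C(#|Y| - #|X|, k).
  move=> sX; rewrite -[in RHS](setIidPr sX) -cardsD -card_draws.
  by apply: eq_card => E; rewrite !inE setI_eq0 subsetD andbAC.
have s12 : T1 :|: T2 \subset Y by rewrite subUset s1.
rewrite -{1}(avoid _ s1) -(avoid _ s2).
have -> : #|T1| + #|T2| = #|T1 :|: T2|.
  by rewrite cardsU (disjoint_setI0 d12) cards0 subn0.
rewrite -(avoid _ s12) -(card_draws Y).
set A1 := [set E in _ | _ == _]; set A2 := [set E in _ | E :&: T2 == _].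
rewrite -addnA -cardsUI addnA; congr (_ + _); last first.
  apply: eq_card => E; rewrite !inE setIUr setU_eq0.
  by case: (E \subset Y); case: (#|E| == k).
rewrite -[in RHS](cardsID (A1 :|: A2)) addnC; congr (_ + _); apply: eq_card => E.
  by rewrite !inE; case: (E \subset Y); case: (#|E| == k); rewrite //= ?andbT ?andbF.
by rewrite !inE; case: (E \subset Y); case: (#|E| == k); rewrite //= ?negb_or ?andbT ?andbF.
Qed.

(** * Double counting between strata *)

Lemma card_setId_sum (X : finType) (N : {set X}) (p : pred X) :
  #|[set y in N | p y]| = \sum_(y in N) p y.
Proof.
rewrite -sum1_card big_mkcond [RHS]big_mkcond; apply: eq_bigr => y _.
by rewrite inE; case: (y \in N); case: (p y).
Qed.

Lemma double_counting_le (X1 X2 : finType) (r : X1 -> X2 -> bool)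
    (A : {set X1}) (N : {set X2}) d1 d2 :
  (forall x, x \in A -> d1 <= #|[set y in N | r x y]|) ->
  (forall y, y \in N -> #|[set x in A | r x y]| <= d2) ->
  #|A| * d1 <= #|N| * d2.
Proof.
move=> h1 h2; rewrite -!sum_nat_const.
apply: (@leq_trans (\sum_(x in A) \sum_(y in N) r x y)).
  by apply: leq_sum => x /h1; rewrite card_setId_sum.
by rewrite exchange_big; apply: leq_sum => y /h2; rewrite card_setId_sum.
Qed.

(** All edges leaving [A] end in [P2 :\: B], so |A| d1 <= (|P2| - |B|) d2. As |P1| d1 = |P2| d2,
    this is |A|/|P1| + |B|/|P2| <= 1 with denominators cleared. *)
Lemma biregular_independent (X1 X2 : finType) (r : X1 -> X2 -> bool)
    (P1 A : {set X1}) (P2 B : {set X2}) d1 d2 :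
  (forall x, x \in P1 -> #|[set y in P2 | r x y]| = d1) ->
  (forall y, y \in P2 -> #|[set x in P1 | r x y]| = d2) -> 0 < d1 ->
  A \subset P1 -> B \subset P2 ->
  (forall x y, x \in A -> y \in B -> ~~ r x y) ->
  #|A| * #|P2| + #|B| * #|P1| <= #|P1| * #|P2|.
Proof.
move=> h1 h2 d1_gt0 sA sB indep.
have le12 : #|P1| * d1 <= #|P2| * d2.
  by apply: (double_counting_le (r := r)) => [x /h1->|y /h2->].
have le21 : #|P2| * d2 <= #|P1| * d1.
  by apply: (double_counting_le (r := fun y x => r x y)) => [x /h2->|y /h1->].
have leA : #|A| * d1 <= #|P2 :\: B| * d2.
  apply: (double_counting_le (r := r)) => [x xA|y].
    rewrite -(h1 x (subsetP sA _ xA)) subset_leq_card //; apply/subsetP=> y.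
    rewrite !inE => /andP[-> rxy]; rewrite rxy !andbT.
    by apply/negP => /(indep x y xA); rewrite rxy.
  rewrite inE => /andP[_ /h2 <-]; apply: subset_leq_card.
  by apply/subsetP => x; rewrite !inE => /andP[/(subsetP sA)-> ->].
move: leA; rewrite cardsD (setIidPr sB) mulnBl => leA.
have leB := subset_leq_card sB; have leA' := subset_leq_card sA.
have [P10|P1_gt0] := posnP #|P1|.
  by move: leA'; rewrite P10 leqn0 => /eqP ->; rewrite !muln0.
have d2_gt0 : 0 < d2.
  by rewrite lt0n; apply: contraTneq le12 => ->; rewrite muln0 -ltnNge muln_gt0 P1_gt0 d1_gt0.
have e12 : #|P1| * d1 = #|P2| * d2 by apply/eqP; rewrite eqn_leq le12.
have leA2 : #|A| * d1 + #|B| * d2 <= #|P2| * d2.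
  have := leq_mul leB (leqnn d2); lia.
rewrite -(leq_pmul2r d2_gt0) mulnDl.
have -> : #|A| * #|P2| * d2 = #|P1| * (#|A| * d1).
  by rewrite -mulnA -e12 mulnCA.
by rewrite [#|B| * _]mulnC -!mulnA -mulnDr leq_mul.
Qed.

Definition stratum (T : finType) (Y K : {set T}) k t : {set {set T}} :=
  [set A in draws Y k | #|A :&: K| == t].

Lemma stratumP (T : finType) (Y K A : {set T}) k t :
  reflect [/\ A \subset Y, #|A| = k & #|A :&: K| = t] (A \in stratum Y K k t).
Proof.
rewrite 2!inE; apply: (iffP idP) => [/andP[/andP[? /eqP?] /eqP?]|[-> -> ->]] //.
by rewrite !eqxx.
Qed.

Lemma card_stratum (T : finType) (Y K : {set T}) k t :
  K \subset Y -> t <= k ->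
  #|stratum Y K k t| = 'C(#|K|, t) * 'C(#|Y| - #|K|, k - t).
Proof.
move=> sKY letk.
have d : [disjoint K & Y :\: K] by rewrite disjoint_sym disjoints_subset subsetDr.
have -> : #|Y| - #|K| = #|Y :\: K| by rewrite cardsD (setIidPr sKY).
rewrite -(card_draws2 _ _ d); apply: eq_card => A.
have eY : K :|: (Y :\: K) = Y.
  by rewrite setDE setUIr setUCr setIT (setUidPr sKY).
rewrite !inE eY; case sAY : (A \subset Y) => //=.
have := cardsID K A; have -> : A :\: K = A :&: (Y :\: K).
  by rewrite setIDA (setIidPl sAY).
by case: eqP; case: eqP; case: eqP => //=; lia.
Qed.

(** A neighbour [B] consists of [s] points of [K :\: A], [e] points of [A :\: K] and the remaining k
    - (s + e) points outside both sets; the three choices are independent. *)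
Lemma stratum_degree (T : finType) (Y K A : {set T}) k t s e :
  K \subset Y -> A \in stratum Y K k t -> s + e <= k ->
  #|[set B in stratum Y K k s | (A :&: B :&: K == set0) && (#|A :&: B| == e)]| =
  'C(#|K| - t, s) *
    ('C(k - t, e) * 'C(#|Y| - #|K| - (k - t), k - (s + e))).
Proof.
move=> sKY /stratumP[sAY cA cAK] lek.
set X1 := K :\: A; set X2 := A :\: K; set X3 := Y :\: (K :|: A).
have d12 : [disjoint X1 & X2].
  by rewrite -setI_eq0; apply/eqP/setP=> x; rewrite !inE; case: (x \in K); case: (x \in A); rewrite /= ?andbF.
have d13 : [disjoint X1 & X3].
  by rewrite -setI_eq0; apply/eqP/setP=> x; rewrite !inE; case: (x \in K); case: (x \in A); rewrite /= ?andbF.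
have d23 : [disjoint X2 & X3].
  by rewrite -setI_eq0; apply/eqP/setP=> x; rewrite !inE; case: (x \in K); case: (x \in A); rewrite /= ?andbF.
have c1 : #|X1| = #|K| - t by rewrite cardsD setIC cAK.
have c2 : #|X2| = k - t by rewrite cardsD cAK cA.
have c3 : #|X3| = #|Y| - #|K| - (k - t).
  rewrite cardsD (setIidPr _) ?subUset ?sKY // cardsU setIC cAK.
  have := subset_leq_card (subsetIl A K); rewrite cAK cA; lia.
rewrite -c1 -c3 -c2 -(card_draws3 _ _ _ d12 d13 d23); apply: eq_card => B.
have [eBK eAB eB] : [/\ #|B :&: K| = #|B :&: X1| + #|A :&: B :&: K|,
    #|A :&: B| = #|B :&: X2| + #|A :&: B :&: K| &
    B \subset Y -> #|B| = #|B :&: X1| + #|B :&: X2| + #|B :&: X3| + #|A :&: B :&: K|].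
  have e1 : #|B :&: K| = #|B :&: X1| + #|A :&: B :&: K|.
    rewrite -(cardsID A (B :&: K)) addnC -setIDA; congr (_ + #|pred_of_set _|).
    by rewrite setIAC [B :&: A]setIC.
  have e2 : #|A :&: B| = #|B :&: X2| + #|A :&: B :&: K|.
    rewrite -(cardsID K (A :&: B)) addnC; congr (#|pred_of_set _| + _).
    by rewrite setIDA setIC.
  split=> // sBY; rewrite -(cardsID K B) e1 -(cardsID A (B :\: K)).
  have -> : (B :\: K) :&: A = B :&: X2 by rewrite setIDA !setDE setIAC.
  have -> : B :\: K :\: A = B :&: X3 by rewrite setIDA (setIidPl sBY) setDDl.
  by lia.
have eS : (B \subset X1 :|: (X2 :|: X3)) = (B \subset Y) && (#|A :&: B :&: K| == 0).
  rewrite cards_eq0; apply/idP/andP => [sB|[sBY /eqP z0]].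
    split; first by apply: subset_trans sB _; rewrite !subUset !(subset_trans (subsetDl _ _)).
    apply/eqP/setP => x; rewrite !inE; apply/negP => /andP[/andP[xA xB] xK].
    by have := subsetP sB x xB; rewrite !inE xA xK.
  apply/subsetP => x xB; rewrite !inE (subsetP sBY) //.
  by move/setP/(_ x): z0; rewrite !inE xB; case: (x \in A); case: (x \in K).
rewrite !inE eS -cards_eq0 eBK eAB; case sBY : (B \subset Y) => //=.
rewrite (eB sBY); lia.
Qed.

(** * Cross-intersecting families pushed into a core *)

Definition cross (T : finType) (F G : {set {set T}}) : bool :=
  [forall A in F, forall B in G, A :&: B != set0].

Lemma crossP (T : finType) (F G : {set {set T}}) :
  reflect (forall A B, A \in F -> B \in G -> A :&: B != set0) (cross F G).
Proof.
apply: (iffP forall_inP) => [h A B AF BG|h A AF].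
  by move/forall_inP: (h A AF); apply.
by apply/forall_inP => B; apply: h.
Qed.

Lemma crossC (T : finType) (F G : {set {set T}}) : cross F G = cross G F.
Proof.
by apply/crossP/crossP => h A B ha hb; rewrite setIC; apply: h.
Qed.

Definition pushed_into (T : finType) (K : {set T}) (F : {set {set T}}) : Prop :=
  forall A w z, A \in F -> w \in K -> w \notin A -> z \in A -> z \notin K ->
  w |: A :\ z \in F.

(** The exchanges are made one pair at a time, in any order: after swapping [z] for [w], the sets
    [D :\ w] and [Z :\ z] satisfy the same hypotheses relative to the new member. *)
Lemma pushed_intoW (T : finType) (K A D Z : {set T}) (F : {set {set T}}) :
  pushed_into K F -> A \in F -> D \subset K -> [disjoint D & A] ->
  Z \subset A :\: K -> #|D| = #|Z| -> D :|: (A :\: Z) \in F.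
Proof.
move=> pF; move eqd: #|D| => d.
elim: d D Z A eqd => [|d IH] D Z A cD AF sDK dDA sZ cZ.
  have /eqP -> : D == set0 by rewrite -cards_eq0 cD.
  have /eqP -> : Z == set0 by rewrite -cards_eq0 -cZ.
  by rewrite set0U setD0.
have /card_gt0P[w wD] : 0 < #|D| by rewrite cD.
have /card_gt0P[z zZ] : 0 < #|Z| by rewrite -cZ.
have wK := subsetP sDK _ wD; have wA : w \notin A by rewrite (disjointFr dDA).
have /setDP[zA zK] := subsetP sZ _ zZ.
have cw := cardsD1 w D; have cz := cardsD1 z Z; rewrite wD in cw; rewrite zZ in cz.
have wz : w != z by apply: contraNneq zK => <-.
have := IH (D :\ w) (Z :\ z) (w |: A :\ z).
have -> : D :\ w :|: ((w |: A :\ z) :\: (Z :\ z)) = D :|: (A :\: Z).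
  apply/setP => x; rewrite !inE.
  have [->|xw] /= := eqVneq x w.
    by rewrite wD wz /= andbT; apply/negP => /(subsetP sZ); rewrite inE wK.
  have [->|xz] //= := eqVneq x z.
  by rewrite zZ.
apply.
- by lia.
- exact: pF.
- by apply: subset_trans sDK; apply: subsetDl.
- rewrite -setI_eq0; apply/eqP/setP => x; rewrite !inE.
  have [->|xw] //= := eqVneq x w; case xD: (x \in D) => //=.
  by rewrite (disjointFr dDA xD) andbF.
- apply/subsetP => x; rewrite !inE => /andP[xz /(subsetP sZ)].
  by rewrite !inE xz => /andP[-> ->]; rewrite orbT.
- by lia.
Qed.

(* If [A] and [B] meet only outside [K], in at most [#|K| - t - s] points, these
   points of [A] can be pushed into [K :\: (A :|: B)], so that [A] in [F] and
   [B] in [G] are incompatible. *)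
Lemma core_stratum_le (T : finType) (Y K : {set T}) (F G : {set {set T}}) k t s e :
  K \subset Y -> cross F G -> pushed_into K F ->
  s + t + e <= #|K| -> t + e <= k -> s + e <= k ->
  2 * k <= #|Y| - #|K| + (s + t + e) ->
  #|F :&: stratum Y K k t| * #|stratum Y K k s|
    + #|G :&: stratum Y K k s| * #|stratum Y K k t|
  <= #|stratum Y K k t| * #|stratum Y K k s|.
Proof.
move=> sKY /crossP FG pF leK ltk lsk leY.
apply: (@biregular_independent _ _
  (fun A B : {set T} => (A :&: B :&: K == set0) && (#|A :&: B| == e)) _ _ _ _
  ('C(#|K| - t, s) * ('C(k - t, e) * 'C(#|Y| - #|K| - (k - t), k - (s + e))))
  ('C(#|K| - s, t) * ('C(k - s, e) * 'C(#|Y| - #|K| - (k - s), k - (t + e)))));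
  try exact: subsetIr.
- by move=> A At; apply: stratum_degree.
- move=> B Bs; rewrite -(stratum_degree sKY Bs) //.
  by apply: eq_card => A; rewrite !inE [B :&: A]setIC.
(* [leY] makes the third factor positive: it provides room outside [K] and [A] for the remaining
   points of a neighbour. *)
- by rewrite !muln_gt0 !bin_gt0; lia.
move=> A B /setIP[AF /stratumP[sAY cA cAK]] /setIP[BG /stratumP[sBY cB cBK]].
apply/negP => /andP[/eqP ABK /eqP cAB].
have le1 : e <= #|K :\: (A :|: B)|.
  rewrite cardsD setIUr cardsU ![K :&: _]setIC cAK cBK.
  have -> : (A :&: K) :&: (B :&: K) = set0 by rewrite setIACA setIid.
  by rewrite cards0; lia.
have [|D /drawsP[sD cD] _] := @exists_draw _ set0 (K :\: (A :|: B)) e (sub0set _).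
  by rewrite cards0.
have dDAB : [disjoint D & A :|: B] by move: sD; rewrite subsetD => /andP[].
suff A'F : D :|: (A :\: (A :&: B)) \in F.
  have := FG _ _ A'F BG; rewrite setIUl.
  have -> : D :&: B = set0.
    by apply: disjoint_setI0; apply: disjointWr dDAB; apply: subsetUr.
  have -> : (A :\: (A :&: B)) :&: B = set0.
    by apply/setP => x; rewrite !inE; case: (x \in A); case: (x \in B).
  by rewrite setU0 eqxx.
apply: (@pushed_intoW _ K) => //.
- by apply: subset_trans sD _; apply: subsetDl.
- by apply: disjointWr dDAB; apply: subsetUl.
- apply/subsetP => x xAB; rewrite inE; have /setIP[-> _] := xAB; rewrite andbT.
  by apply/negP => xK; have : x \in A :&: B :&: K by [rewrite inE xAB]; rewrite ABK inE.
- by rewrite cD.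
Qed.

(** Binomials grow up to the middle of the row; a [j] beyond the middle is reflected to N - j, which
    is still at least [i]. *)
Lemma leq_bin_unimodal N i j : i <= j -> i + j <= N -> 'C(N, i) <= 'C(N, j).
Proof.
have up a : 2 * a < N -> 'C(N, a) <= 'C(N, a.+1).
  move=> lta; rewrite -(@leq_pmul2l a.+1) // mul_bin_left.
  by rewrite leq_mul2r; apply/orP; right; lia.
have chain a b : a <= b -> 2 * b <= N -> 'C(N, a) <= 'C(N, b).
  move=> leab; rewrite -(subnK leab) addnC.
  elim: (b - a) => [|d IH] leN; first by rewrite addn0.
  by rewrite addnS (leq_trans (IH _) (up _ _)) //; lia.
move=> leij leN; have [le2j|lt2j] := leqP (2 * j) N; first exact: chain.
rewrite -(@bin_sub N j); last lia.
by apply: chain; lia.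
Qed.

(** For t <= s, the stratum [t] is the larger one. Comparing it with stratum [s] in both directions
    bounds a mixed sum; comparing it with itself bounds its own share by [qt], and the latter
    inequality, weighted by qt - qs, evens out the coefficients. *)
Lemma core_strata_pair_le (T : finType) (Y K : {set T}) (F G : {set {set T}}) k t s :
  K \subset Y -> cross F G -> pushed_into K F ->
  t + s = #|K| -> t <= k -> s <= k -> 2 * k <= #|Y| ->
  #|F :&: stratum Y K k t| + #|G :&: stratum Y K k t|
    + (#|F :&: stratum Y K k s| + #|G :&: stratum Y K k s|)
  <= #|stratum Y K k t| + #|stratum Y K k s|.
Proof.
move=> sKY FG pF; wlog lets : t s / t <= s => [wl|] cK letk lesk leY.
  have [/wl|/ltnW/wl h] := leqP t s; first exact.
  by rewrite addnC [X in _ <= X]addnC; apply: h => //; rewrite addnC.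
have leKY := subset_leq_card sKY.
have le1 : #|F :&: stratum Y K k t| * #|stratum Y K k s|
    + #|G :&: stratum Y K k s| * #|stratum Y K k t|
    <= #|stratum Y K k t| * #|stratum Y K k s|.
  by apply: (core_stratum_le (e := 0)) => //; lia.
have le2 : #|F :&: stratum Y K k s| * #|stratum Y K k t|
    + #|G :&: stratum Y K k t| * #|stratum Y K k s|
    <= #|stratum Y K k s| * #|stratum Y K k t|.
  by apply: (core_stratum_le (e := 0)) => //; lia.
(* With e = s - t one has t + t + e = |K|, so [K] has just enough free points to push apart two sets
   of stratum [t]. *)
have le3 : #|F :&: stratum Y K k t| * #|stratum Y K k t|
    + #|G :&: stratum Y K k t| * #|stratum Y K k t|
    <= #|stratum Y K k t| * #|stratum Y K k t|.
  by apply: (core_stratum_le (e := s - t)) => //; lia.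
have qt_gt0 : 0 < #|stratum Y K k t|.
  by rewrite card_stratum // muln_gt0 !bin_gt0; lia.
have leq_ts : #|stratum Y K k s| <= #|stratum Y K k t|.
  rewrite !card_stratum // -(@bin_sub _ t); last lia.
  have -> : #|K| - t = s by lia.
  by rewrite leq_mul2l leq_bin_unimodal ?orbT //; lia.
move: le1 le2 le3 qt_gt0 leq_ts.
set a_t := #|F :&: stratum _ _ _ t|; set b_t := #|G :&: stratum _ _ _ t|.
set a_s := #|F :&: stratum _ _ _ s|; set b_s := #|G :&: stratum _ _ _ s|.
set qt := #|stratum _ _ _ t|; set qs := #|stratum _ _ _ s|.
move: a_t b_t a_s b_s qt qs => a_t b_t a_s b_s qt qs le1 le2 le3 qt_gt0 leq_ts.
have le3' : a_t + b_t <= qt by rewrite -(leq_pmul2r qt_gt0) mulnDl.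
rewrite -(leq_pmul2r qt_gt0).
have : (a_t + b_t) * (qt - qs) <= qt * (qt - qs) by rewrite leq_mul2r le3' orbT.
nia.
Qed.

(** * Compressions *)

Definition band (T : finType) (K : {set T}) (F : {set {set T}}) lo hi :=
  [set A in F | lo <= #|A :&: K| <= hi].

Lemma card_band (T : finType) (Y K : {set T}) (F : {set {set T}}) k lo hi :
  F \subset draws Y k ->
  #|band K F lo hi| =
  \sum_(t < #|K|.+1 | lo <= t <= hi) #|F :&: stratum Y K k t|.
Proof.
move=> sF; rewrite -sum1_card.
have leK A : #|A :&: K| < #|K|.+1 by rewrite ltnS subset_leq_card ?subsetIr.
rewrite (partition_big (fun A => Ordinal (leK A)) (fun t => lo <= t <= hi)) /=;
  last by move=> A; rewrite inE => /andP[].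
apply: eq_bigr => t lot; rewrite -[RHS]sum1_card; apply: eq_bigl => A.
rewrite !inE -val_eqE /=.
case AF: (A \in F) => //=; have := subsetP sF _ AF; rewrite inE => -> /=.
by case: eqP => [->|]; rewrite ?lot ?andbF.
Qed.

(** Since lo + hi = |K|, the reflection of [t] to |K| - t preserves the band. Adding the inequality
    for each reflected pair counts every stratum twice, hence the factor 2. *)
Lemma core_band_le (T : finType) (Y K : {set T}) (F G : {set {set T}}) k lo hi :
  K \subset Y -> F \subset draws Y k -> G \subset draws Y k ->
  cross F G -> pushed_into K F -> lo + hi = #|K| -> hi <= k -> 2 * k <= #|Y| ->
  #|band K F lo hi| + #|band K G lo hi| <= #|band K (draws Y k) lo hi|.
Proof.
move=> sKY sF sG FG pF cK lehk leY; rewrite !(card_band _ (Y := Y) (k := k)) //.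
rewrite -big_split /=.
have fold (f : nat -> nat) : 2 * (\sum_(t < #|K|.+1 | lo <= t <= hi) f t) =
    \sum_(t < #|K|.+1 | lo <= t <= hi) (f t + f (#|K| - t)).
  rewrite big_split /= mul2n -addnn; congr (_ + _).
  rewrite (reindex_inj rev_ord_inj) /=; apply: eq_big => [t|t _]; last by rewrite subSS.
  have := ltn_ord t; rewrite subSS; lia.
rewrite -(@leq_pmul2l 2) //.
rewrite (fold (fun t => #|F :&: stratum Y K k t| + #|G :&: stratum Y K k t|)).
rewrite (fold (fun t => #|draws Y k :&: stratum Y K k t|)).
apply: leq_sum => t /andP[lot thi].
have ltK := ltn_ord t.
have se u : draws Y k :&: stratum Y K k u = stratum Y K k u.
  by apply/setIidPr/subsetP => A; rewrite inE => /andP[].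
by rewrite !se; apply: core_strata_pair_le => //; lia.
Qed.

(** The usual compression replacing [z] by [w]. A set whose image is already in [F] stays in place,
    which keeps the map injective on [F]. *)
Definition shift_set (T : finType) (w z : T) (F : {set {set T}}) (A : {set T}) :=
  if [&& z \in A, w \notin A & w |: A :\ z \notin F] then w |: A :\ z else A.

Definition shift (T : finType) (w z : T) (F : {set {set T}}) :=
  shift_set w z F @: F.

Lemma shift_set_inj (T : finType) (w z : T) (F : {set {set T}}) :
  {in F &, injective (shift_set w z F)}.
Proof.
move=> A B AF BF; rewrite /shift_set.
case: ifP => [/and3P[zA wA nA]|_]; case: ifP => [/and3P[zB wB nB]|_] //.
- move=> e; have rec (C : {set T}) : z \in C -> w \notin C ->
      z |: (w |: C :\ z) :\ w = C.
    move=> zC wC; rewrite setU1K ?setD1K // !inE negb_and wC orbT //.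
  by rewrite -(rec A) // -[RHS](rec B) // e.
- by move=> e; rewrite e BF in nA.
- by move=> e; rewrite -e AF in nB.
Qed.

Lemma card_shift (T : finType) (w z : T) (F : {set {set T}}) :
  #|shift w z F| = #|F|.
Proof. by rewrite card_in_imset //; apply: shift_set_inj. Qed.

Lemma shift_draws (T : finType) (w z : T) (Y : {set T}) (F : {set {set T}}) k :
  w \in Y -> F \subset draws Y k -> shift w z F \subset draws Y k.
Proof.
move=> wY sF; apply/subsetP => _ /imsetP[A AF ->].
have /drawsP[sA cA] := subsetP sF _ AF; apply/drawsP; rewrite /shift_set.
case: ifP => [/and3P[zA wA _]|_] //; split.
  by rewrite subUset sub1set wY (subset_trans (subsetDl _ _)).
by rewrite cardsU1 !inE negb_and wA orbT -cA (cardsD1 z A) zA.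
Qed.

(** The delicate case is a moved [C] against an unmoved [D] containing [z] but not [w]. Then the
    exchange of [D] is itself a member, and [C] meets it in a point other than [w] and [z], which
    lies in both sets at stake. *)
Lemma shift_cross (T : finType) (w z : T) (F G : {set {set T}}) :
  cross F G -> cross (shift w z F) (shift w z G).
Proof.
move=> /crossP FG; apply/crossP => _ _ /imsetP[A AF ->] /imsetP[B BG ->].
have half (F' G' : {set {set T}}) (C D : {set T}) :
    (forall A B, A \in F' -> B \in G' -> A :&: B != set0) ->
    C \in F' -> D \in G' -> z \in C -> w \notin C ->
    ~~ [&& z \in D, w \notin D & w |: D :\ z \notin G'] ->
    (w |: C :\ z) :&: D != set0.
  move=> FG' CF DG zC wC nD; have /set0Pn[x /setIP[xC xD]] := FG' _ _ CF DG.
  apply/set0Pn; have [wD|wD] := boolP (w \in D).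
    by exists w; rewrite !inE eqxx.
  have [xz|xz] := eqVneq x z; last by exists x; rewrite !inE xz xC xD orbT.
  move: nD; rewrite -xz xD wD /= negbK xz => DG'.
  have /set0Pn[y /setIP[yC]] := FG' _ _ CF DG'.
  rewrite !inE => /orP[/eqP yw|/andP[yz yD]]; first by rewrite -yw yC in wC.
  by exists y; rewrite !inE yz yC yD orbT.
rewrite /shift_set; case: ifP => [/and3P[zA wA _]|/negbT nA];
  case: ifP => [/and3P[zB wB _]|/negbT nB].
- by apply/set0Pn; exists w; rewrite !inE eqxx.
- exact: half AF BG zA wA nB.
- rewrite setIC; apply: half BG AF zB wB nA => B' A' ? ?; rewrite setIC.
  exact: FG.
- exact: FG.
Qed.

(** The potential of the compression argument: a compression into [K] increases it strictly unless
    no member moves. *)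
Definition weight (T : finType) (K : {set T}) (F : {set {set T}}) :=
  \sum_(A in F) #|A :&: K|.

Lemma shift_set_weight (T : finType) (w z : T) (K A : {set T}) (F : {set {set T}}) :
  w \in K -> z \notin K -> #|A :&: K| <= #|shift_set w z F A :&: K| ?= iff
    (shift_set w z F A == A).
Proof.
move=> wK zK; rewrite /shift_set; case: ifP => [/and3P[zA wA _]|_]; last first.
  by rewrite eqxx; apply/leqif_refl.
have -> : (w |: A :\ z) :&: K = w |: (A :&: K).
  apply/setP => x; rewrite !inE; have [->|] //= := eqVneq x w.
  have [->|] //= := eqVneq x z; by rewrite (negPf zK) andbF.
rewrite cardsU1 inE (negPf wA) /=; split; first by lia.
have -> : (w |: A :\ z == A) = false.
  by apply/eqP => /setP/(_ w); rewrite !inE eqxx (negPf wA).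
by lia.
Qed.

Lemma shift_weight (T : finType) (w z : T) (K : {set T}) (F : {set {set T}}) :
  w \in K -> z \notin K -> weight K F <= weight K (shift w z F).
Proof.
move=> wK zK; rewrite /weight big_imset /=; last exact: shift_set_inj.
by apply: leq_sum => A AF; apply: shift_set_weight.
Qed.

Lemma shift_weight_eq (T : finType) (w z : T) (K : {set T}) (F : {set {set T}}) :
  w \in K -> z \notin K -> weight K (shift w z F) <= weight K F ->
  forall A : {set T}, A \in F -> w \notin A -> z \in A -> w |: A :\ z \in F.
Proof.
move=> wK zK; rewrite /weight big_imset /=; last exact: shift_set_inj.
move=> leW A AF wA zA; apply/negPn/negP => nA; move: leW; apply/negP; rewrite -ltnNge.
rewrite (bigD1 A AF) [X in _ < X](bigD1 A AF) /= -addSn leq_add //; last first.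
  by apply: leq_sum => B BF; apply: shift_set_weight.
rewrite (ltn_leqif (shift_set_weight A F wK zK)) /shift_set zA wA nA /=.
by apply/eqP => /setP/(_ w); rewrite !inE eqxx (negPf wA).
Qed.

Lemma exists_argmax (X : finType) (P : pred X) (f : X -> nat) x0 :
  P x0 -> exists2 x, P x & forall y, P y -> f y <= f x.
Proof. by move=> Px0; case: (arg_maxnP f Px0) => x Px max_x; exists x. Qed.

(** The points of [A] outside [K] are exchanged for those of [L :\: A]; the two numbers agree
    because [A] meets [K] and [L] in the same set. *)
Lemma pushed_into_core (T : finType) (K L A : {set T}) (F : {set {set T}}) :
  pushed_into K F -> A \in F -> L \subset K -> #|L| = #|A| -> A :&: K \subset L ->
  L \in F.
Proof.
move=> pF AF sLK cL sAL.
have := @pushed_intoW _ K A (L :\: A) (A :\: K) F pF AF.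
have -> : L :\: A :|: (A :\: (A :\: K)) = L.
  rewrite setDDr setDv set0U; apply/setP => x; rewrite !inE.
  have := subsetP sAL x; rewrite inE.
  case xA: (x \in A) => //=; last by rewrite orbF.
  have := subsetP sLK x; case: (x \in L) => /=; first by move=> ->.
  by case: (x \in K) => //= _ /(_ isT).
apply=> //.
- by apply: subset_trans sLK; apply: subsetDl.
- by rewrite disjoints_subset subsetDr.
have eK : A :&: K = A :&: L.
  by apply/eqP; rewrite eqEsubset subsetI subsetIl sAL setIS.
by rewrite !cardsD cL [L :&: A]setIC eK.
Qed.

(* Hilton and Milner's bound for non-empty cross-intersecting families:
   pushing both families into a member [K] of [F] keeps [K] in [F] and, as [G]
   is non-empty, brings [K] into [G]; the strata other than [K] itself are then
   controlled by [core_band_le]. *)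
Lemma cross_nonempty_le (T : finType) (Y : {set T}) (F G : {set {set T}}) k :
  F \subset draws Y k -> G \subset draws Y k -> F != set0 -> G != set0 ->
  cross F G -> 2 * k <= #|Y| ->
  #|F| + #|G| + 'C(#|Y| - k, k) <= 'C(#|Y|, k) + 1.
Proof.
have arith a b c d e f g : a <= c + 1 -> b <= d + 1 -> c + d <= e ->
    e + (f + 1) <= g -> a + b + f <= g + 1 by lia.
move=> sF sG /set0Pn[K KF] /set0Pn[B BG] FG leY.
have /drawsP[sKY cK] := subsetP sF _ KF.
pose P (p : {set {set T}} * {set {set T}}) :=
  [&& p.1 \subset draws Y k, p.2 \subset draws Y k, cross p.1 p.2,
      K \in p.1, p.2 != set0 & (#|p.1| == #|F|) && (#|p.2| == #|G|)].
have P0 : P (F, G).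
  by rewrite /P /= sF sG FG KF !eqxx /= andbT; apply/set0Pn; exists B.
have [[F' G'] /and5P[/= sF' sG' FG' KF' /andP[G'0 /andP[/eqP cF /eqP cG]]] maxW] :=
  exists_argmax (fun p => weight K p.1 + weight K p.2) P0.
rewrite -cF -cG {P0}.
have pushed : pushed_into K F' /\ pushed_into K G'.
  have W w z : w \in K -> z \notin K ->
      weight K (shift w z F') + weight K (shift w z G') <= weight K F' + weight K G'.
    move=> wK zK; apply: (maxW (shift w z F', shift w z G')).
    rewrite /P /= !card_shift cF cG !eqxx !shift_draws ?(subsetP sKY) // shift_cross //=.
    rewrite andbT -cards_eq0 card_shift cards_eq0 G'0 andbT.
    (* [K] contains [w], so the compression does not move it and it stays in the first family. *)
    by apply/imsetP; exists K => //; rewrite /shift_set wK andbF.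
  split=> A w z AF wK wA zA zK; apply: (shift_weight_eq wK zK _ AF wA zA).
    rewrite -(leq_add2r (weight K G')); apply: leq_trans (W w z wK zK).
    by rewrite leq_add2l shift_weight.
  rewrite -(leq_add2l (weight K F')); apply: leq_trans (W w z wK zK).
  by rewrite leq_add2r shift_weight.
have [pF pG] := pushed; clear P pushed maxW.
have KG : K \in G'.
  have /set0Pn[B' BG'] := G'0; have /drawsP[_ cB'] := subsetP sG' _ BG'.
  by apply: (pushed_into_core pG BG'); rewrite ?subsetIr // cK cB'.
have card1 (H : {set {set T}}) : H \subset draws Y k ->
    (forall A, A \in H -> A :&: K != set0) -> #|H| <= #|band K H 1 k.-1| + 1.
  move=> sH meetH; rewrite -[X in _ <= _ + X](cards1 K) -(cardsID [set K] H) addnC leq_add //; last first.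
    by rewrite subset_leq_card ?subsetIr.
  apply/subset_leq_card/subsetP => A /setDP[AH]; rewrite !inE AH /= => AK.
  have /drawsP[sAY cA] := subsetP sH _ AH.
  have A0 := meetH A AH; rewrite -card_gt0 in A0; rewrite A0 /=.
  have : #|A :&: K| < k; last by clear; lia.
  rewrite ltn_neqAle -{2}cK subset_leq_card ?subsetIr // andbT.
  apply: contraNneq AK => cAK; rewrite eqEcard cA cK leqnn andbT.
  by apply/setIidPl/eqP; rewrite eqEcard subsetIl cAK cA leqnn.
have meetF A : A \in F' -> A :&: K != set0 by move=> AF; move/crossP: FG'; apply.
have meetG A : A \in G' -> A :&: K != set0.
  by move=> AG; rewrite setIC; move/crossP: FG'; apply.
have k_gt0 : 0 < k.
  by rewrite -cK -(setIid K) card_gt0; apply: meetF.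
have leF := card1 _ sF' meetF; have leG := card1 _ sG' meetG.
have leB : #|band K F' 1 k.-1| + #|band K G' 1 k.-1| <= #|band K (draws Y k) 1 k.-1|.
  by apply: core_band_le; rewrite ?cK ?add1n ?prednK ?leq_pred.
(* Outside the band lie [K] itself and the sets disjoint from [K]. *)
have : #|band K (draws Y k) 1 k.-1| + ('C(#|Y| - k, k) + 1) <= 'C(#|Y|, k).
  rewrite -card_draws -(cardsID (band K (draws Y k) 1 k.-1) (draws Y k)) leq_add //.
    by rewrite subset_leq_card // subsetI subxx andbT; apply/subsetP => A /setIdP[].
  have -> : 'C(#|Y| - k, k) = #|stratum Y K k 0|.
    by rewrite card_stratum // bin0 mul1n subn0 cK.
  rewrite addnC.
  have <- : #|K |: stratum Y K k 0| = 1 + #|stratum Y K k 0|.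
    by rewrite cardsU1 !inE setIid cK (gtn_eqF k_gt0) andbF.
  apply/subset_leq_card/subsetP => A; rewrite !inE => /orP[/eqP->|].
    by rewrite setIid cK sKY eqxx /= andbT k_gt0 -ltnNge ltn_predL k_gt0.
  by case/andP=> /andP[-> ->] /eqP ->.
exact: arith leF leG leB.
Qed.

(** * Transversals *)

Lemma card_setId_split (X : finType) (S : {set X}) (p : pred X) :
  #|S| = #|[set x in S | p x]| + #|[set x in S | ~~ p x]|.
Proof.
rewrite -(cardsID [set x | p x] S); congr (_ + _); apply: eq_card => x.
  by rewrite !inE.
by rewrite !inE andbC.
Qed.

(** Double counting of disjoint pairs: a set of [R] disjoint from some [D] in [DD] cannot be in
    [GG], while a [k]-set is disjoint from at most C(|Y| - k, k - 2) sets of size k - 2. The surplus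
    [b] serves to make the comparison strict. *)
Lemma pair_matching_le (T : finType) (Y : {set T}) (DD GG R : {set {set T}}) k b :
  DD \subset draws Y (k - 2) -> R \subset draws Y k -> GG \subset R ->
  cross DD GG ->
  (forall D, D \in DD ->
    'C(#|Y| - k, k - 2) + b <= #|[set E in R | [disjoint D & E]]|) ->
  #|DD| * ('C(#|Y| - k, k - 2) + b) <= (#|R| - #|GG|) * 'C(#|Y| - k, k - 2).
Proof.
move=> sD sR sG /crossP DG deg.
have -> : #|R| - #|GG| = #|R :\: GG| by rewrite cardsD (setIidPr sG).
apply: (double_counting_le (r := fun D E : {set T} => [disjoint D & E])).
  move=> D DD_D; apply: leq_trans (deg D DD_D) _.
  apply/subset_leq_card/subsetP => E; rewrite !inE => /andP[-> dDE].
  rewrite dDE !andbT; apply/negP => EG.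
  by have := DG _ _ DD_D EG; rewrite setI_eq0 dDE.
move=> E /setDP[/(subsetP sR)/drawsP[sEY cE] _].
have -> : #|Y| - k = #|Y :\: E| by rewrite cardsD (setIidPr sEY) cE.
rewrite -card_draws; apply/subset_leq_card/subsetP => D.
rewrite !inE => /andP[/(subsetP sD)/drawsP[sDY cD] dDE].
by rewrite subsetD sDY dDE cD /=.
Qed.

(** Besides [p] and [q], k - 2 points remain to be chosen among |Y| - k. This is the degree bound of
    the opposite side in [pair_matching_le], so one such pair per [D] suffices. *)
Lemma card_draws_pair (T : finType) (Y D : {set T}) p q k :
  2 <= k -> D \in draws Y (k - 2) -> p \in Y :\: D -> q \in Y :\: D -> p != q ->
  #|[set E in draws Y k | ([set p; q] \subset E) && [disjoint E & D]]| =
  'C(#|Y| - k, k - 2).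
Proof.
move=> lek /drawsP[sD cD] /setDP[pY pD] /setDP[qY qD] pq.
rewrite card_draws_between.
- rewrite cardsD (setIidPr sD) cD cards2 pq; congr 'C(_, _); lia.
- by rewrite subUset !sub1set pY qY.
- by rewrite disjointsUl !disjoints1 pD qD.
- by rewrite cards2 pq.
Qed.

(* [tau v] is a set missing [v]; the first [v] of the list lying in [E] decides
   whether [E] must meet [tau v], and [E] must meet both [P] and [P'] when it
   contains no [v]. *)
Fixpoint good (T : finType) (tau : T -> {set T}) (P P' : {set T}) (vs : seq T)
    (E : {set T}) : bool :=
  if vs is v :: vs' then
    if v \in E then E :&: tau v != set0 else good tau P P' vs' E
  else (E :&: P != set0) && (E :&: P' != set0).

(** Candidates for a [d]-set [D] equal to [tau v], where [v] is the first element of the list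
    outside [D]. The argument [X] collects the earlier elements, which must lie in [D]. *)
Fixpoint exceptional (T : finType) (tau : T -> {set T}) (d : nat) (vs : seq T)
    (X : {set T}) : seq {set T} :=
  if vs is v :: vs' then
    (if (#|tau v| == d) && (X \subset tau v) then [:: tau v] else [::])
      ++ exceptional tau d vs' (v |: X)
  else [::].

Lemma goodI (T : finType) (tau : T -> {set T}) (P P' E : {set T}) (vs : seq T) :
  {in vs, forall v, E :&: tau v != set0} ->
  ({in vs, forall v, v \notin E} -> (E :&: P != set0) && (E :&: P' != set0)) ->
  good tau P P' vs E.
Proof.
elim: vs => [|v vs IH] /= h h0; first exact: h0.
case: ifP => [_|/negbT vE]; first by apply: h; rewrite mem_head.
apply: IH => [u uvs|h1]; first by apply: h; rewrite inE uvs orbT.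
by apply: h0 => u; rewrite inE => /orP[/eqP->|/h1].
Qed.

(** If [v] is the first element of the list outside [D], take p = v and [q] in [tau v] outside [D];
    by size, [q] is missing only if tau v = D, the exceptional case. If the whole list lies in [D],
    take [p] in [P] and [q] in [P'], both outside [D]. *)
Lemma good_pair (T : finType) (tau : T -> {set T}) (Y P P' D X : {set T}) (vs : seq T) :
  {in vs, forall v, [/\ v \in Y, v \notin tau v, tau v \subset Y & #|D| <= #|tau v|]} ->
  P \subset Y -> P' \subset Y -> [disjoint P & P'] ->
  (X \subset D -> {subset vs <= D} -> ~~ (P \subset D) && ~~ (P' \subset D)) ->
  X \subset D -> D \notin exceptional tau #|D| vs X ->
  exists p q, [/\ p \in Y :\: D, q \in Y :\: D, p != q &
    forall E : {set T}, [disjoint E & D] -> p \in E -> q \in E ->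
      good tau P P' vs E].
Proof.
move=> + sP sP' dP; elim: vs X => [|v vs IH] X h h0 sXD /=.
  move=> _; have sub0 : {subset [::] <= D} by [].
  have /andP[/subsetPn[p pP pD] /subsetPn[q qP qD]] := h0 sXD sub0.
  exists p, q; rewrite !inE pD qD (subsetP sP) // (subsetP sP') //; split=> //.
    by apply: contraTneq qP => <-; rewrite (disjointFr dP).
  by move=> E _ pE qE; apply/andP; split; apply/set0Pn; [exists p|exists q]; rewrite inE ?pE ?qE.
have [vY vtau stau ctau] := h v (mem_head _ _).
rewrite mem_cat negb_or => /andP[nv nvs].
have [vD|vD] := boolP (v \in D).
  have [||||p [q [pY qY pq g]]] := IH (v |: X) => //.
  - by move=> u uvs; apply: h; rewrite inE uvs orbT.
  - rewrite subUset => /andP[_ sX] svs; apply: h0 => // u.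
    by rewrite inE => /orP[/eqP->|/svs].
  - by rewrite subUset sub1set vD.
  exists p, q; split=> // E dED pE qE.
  by rewrite (disjointFl dED vD); apply: g.
have /subsetPn[q qt qD] : ~~ (tau v \subset D).
  apply/negP => sD; have /eqP eD : tau v == D by rewrite eqEcard sD.
  by move: nv; rewrite eD eqxx sXD mem_head.
exists v, q; rewrite !inE vD qD vY (subsetP stau) //; split=> //.
  by apply: contraTneq qt => <-.
by move=> E _ vE qE; rewrite vE; apply/set0Pn; exists q; rewrite inE qE.
Qed.

Lemma card_draws_through (T : finType) (Z V : {set T}) v k :
  0 < k -> v \in Z -> v \notin V ->
  #|[set E in draws Z k | (v \in E) && (E :&: V == set0)]| = 'C(#|Z :\: V|.-1, k.-1).
Proof.
move=> k0 vZ vV; have := @card_draws_between _ Z [set v] V k.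
rewrite sub1set disjoints1 cards1 !subn1 => /(_ vZ vV k0) <-.
by apply: eq_card => E; rewrite !inE sub1set setI_eq0.
Qed.

(** Induction on the list, splitting by membership of its head [v]. Among the sets through [v], the
    bad ones miss [tau v], which is no larger than [T2], so they are at least as many as those
    missing [T2]. The sets avoiding [v] are left to the induction, with [v] added to [X]; [b] is the
    surplus at the end of the list. *)
Lemma count_not_good (T : finType) (tau : T -> {set T}) (Y P P' T2 X : {set T}) k b (vs : seq T) :
  2 <= k -> T2 \subset Y -> #|T2| = k - 1 -> 2 * k <= #|Y| + 1 ->
  uniq vs -> [disjoint X & T2] ->
  {in vs, forall v, [/\ v \in Y, v \notin X, v \notin T2, v \notin tau v & #|tau v| <= k - 1]} ->
  (forall X', X' = X :|: [set x in vs] ->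
    #|[set E in draws (Y :\: X') k | (E :&: P == set0) || (E :&: T2 == set0)]| + b
    <= #|[set E in draws (Y :\: X') k | ~~ good tau P P' [::] E]|) ->
  #|[set E in draws (Y :\: X) k |
      (all (fun v => v \notin E) vs && (E :&: P == set0)) || (E :&: T2 == set0)]|
    + size (exceptional tau (k - 2) vs X) + b
  <= #|[set E in draws (Y :\: X) k | ~~ good tau P P' vs E]|.
Proof.
move=> lek sT2 cT2 leY; elim: vs X => [|v vs IH] X.
  by move=> _ _ _ /(_ X) /=; rewrite addn0; apply; apply/setP => x; rewrite !inE orbF.
move=> /= /andP[vvs uvs] dX h hb.
have [vY vX vT2 vtau ctau] := h v (mem_head _ _).
have {}IH := IH (v |: X) uvs.
rewrite (card_setId_split _ (fun E : {set T} => v \in E)).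
rewrite [X in _ <= X](card_setId_split _ (fun E : {set T} => v \in E)).
have vYX : v \in Y :\: X by rewrite inE vX.
have e1 : #|[set E in [set E in draws (Y :\: X) k |
      (v \notin E) && all (fun u => u \notin E) vs && (E :&: P == set0)
        || (E :&: T2 == set0)] | v \in E]| = 'C(#|(Y :\: X) :\: T2|.-1, k.-1).
  rewrite -(card_draws_through (k := k) _ vYX vT2) //; last lia.
  by apply: eq_card => E; rewrite !inE; case: (v \in E); rewrite /= ?andbT ?andbF.
have e2 : #|[set E in [set E in draws (Y :\: X) k | ~~ (if v \in E then E :&: tau v != set0
      else good tau P P' vs E)] | v \in E]| = 'C(#|(Y :\: X) :\: tau v|.-1, k.-1).
  rewrite -(card_draws_through (k := k) _ vYX vtau) //; last lia.
  by apply: eq_card => E; rewrite !inE; case: (v \in E); rewrite /= ?andbT ?andbF ?negbK.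
have dr : draws (Y :\: (v |: X)) k = [set E in draws (Y :\: X) k | v \notin E].
  by apply/setP => E; rewrite !inE setUC -setDDl subsetD1 andbAC.
have e3 : [set E in [set E in draws (Y :\: X) k |
      (v \notin E) && all (fun u => u \notin E) vs && (E :&: P == set0)
        || (E :&: T2 == set0)] | v \notin E] =
    [set E in draws (Y :\: (v |: X)) k |
      (all (fun u => u \notin E) vs && (E :&: P == set0)) || (E :&: T2 == set0)].
  by rewrite dr; apply/setP => E; rewrite !inE; case: (v \in E); rewrite /= ?andbT ?andbF.
have e4 : [set E in [set E in draws (Y :\: X) k | ~~ (if v \in E then E :&: tau v != set0
      else good tau P P' vs E)] | v \notin E] =
    [set E in draws (Y :\: (v |: X)) k | ~~ good tau P P' vs E].
  by rewrite dr; apply/setP => E; rewrite !inE; case: (v \in E); rewrite /= ?andbT ?andbF.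
rewrite e1 e2 e3 e4 size_cat.
clear e1 e2 e3 e4 dr.
(* In the exceptional case [tau v] has only k - 2 elements and contains [X], so removing [X] costs
   nothing; the ground set gains a point, and Pascal's rule yields at least one more bad set. *)
have leE : 'C(#|(Y :\: X) :\: T2|.-1, k.-1)
    + size (if (#|tau v| == k - 2) && (X \subset tau v) then [:: tau v] else [::])
    <= 'C(#|(Y :\: X) :\: tau v|.-1, k.-1).
  have cYX := subset_leq_card (subsetDl Y X).
  have c1 : #|(Y :\: X) :\: T2| = #|Y :\: X| - (k - 1).
    by rewrite cardsD (setIidPr _) ?cT2 // subsetD sT2 disjoint_sym.
  have c2 : #|Y :\: X| - #|tau v| <= #|(Y :\: X) :\: tau v|.
    by rewrite [X in _ <= X]cardsD leq_sub2l // subset_leq_card ?subsetIr.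
  case: ifP => [/andP[/eqP ct sXt] | _] /=; last first.
    by rewrite addn0 leq_bin2l // c1; move: c2 ctau; clear; lia.
  have c3 : #|Y| - (k - 2) <= #|(Y :\: X) :\: tau v|.
    rewrite setDDl (setUidPr sXt) cardsD leq_sub2l // -ct.
    by rewrite subset_leq_card ?subsetIr.
  apply: (@leq_trans 'C((#|Y| - k).+1, k.-1)); last first.
    by rewrite leq_bin2l //; move: c3 lek leY; clear; lia.
  have -> : k.-1 = (k - 2).+1 by move: lek; clear; lia.
  rewrite [X in _ <= X]binS; apply: leq_add; last by rewrite bin_gt0; move: lek leY; clear; lia.
  by rewrite leq_bin2l // c1; move: cYX lek; clear; lia.
have arith a1 b1 d1 e1 f1 x1 y1 : a1 + e1 <= x1 -> b1 + f1 + d1 <= y1 ->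
  a1 + b1 + (e1 + f1) + d1 <= x1 + y1 by clear; lia.
apply: arith leE (IH _ _ _).
- by rewrite disjointsUl disjoints1 vT2.
- move=> u uvs'; have /h[uY uX uT2 ut cu] : u \in v :: vs by rewrite inE uvs' orbT.
  by split=> //; rewrite !inE negb_or uX andbT; apply: contraNneq vvs => <-.
- move=> X' eX'; apply: hb; rewrite eX'; apply/setP => x; rewrite !inE.
  by case: (x == v); rewrite ?orbT //= .
Qed.

Lemma card_draws_meeting2C (T : finType) (Y T1 T2 : {set T}) k :
  #|[set E in draws Y k | (E :&: T1 != set0) && (E :&: T2 != set0)]| +
  #|[set E in draws Y k | (E :&: T1 == set0) || (E :&: T2 == set0)]| = 'C(#|Y|, k).
Proof.
rewrite -card_draws [RHS](card_setId_split _ (fun E : {set T} =>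
  (E :&: T1 != set0) && (E :&: T2 != set0))).
by congr (_ + #|pred_of_set _|); apply/setP => E; rewrite !inE negb_and !negbK.
Qed.

(* Take [vs] to enumerate [T1 :&: T2] and [tau v] in [U] missing [v].  The good
   sets include [GG]; a set of [DD] has enough good neighbours unless it is some
   exceptional [tau v], and each exceptional set costs one good set.  Bad sets
   are compared with those missing [T1] or [T2'], where [T2'] is [T2] with
   [T1 :&: T2] replaced by elements outside [T1 :|: T2]. *)
Lemma transversal_le (T : finType) (Y T1 T2 : {set T}) (DD GG U : {set {set T}}) k :
  2 <= k -> 2 * k <= #|Y| + 1 ->
  T1 \in U -> T2 \in U -> #|T1| = k - 1 -> #|T2| = k - 1 -> T1 != T2 ->
  {in U, forall X : {set T}, X \subset Y /\ k - 2 <= #|X| <= k - 1} ->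
  (forall v, exists2 X, X \in U & v \notin X) ->
  DD \subset draws Y (k - 2) -> GG \subset draws Y k -> cross DD GG -> cross U GG ->
  #|DD| + #|GG| + (T1 :&: T2 != set0) + 2 * 'C(#|Y| - (k - 1), k) <=
  'C(#|Y|, k) + 'C(#|Y| - 2 * (k - 1), k).
Proof.
move=> lek leY T1U T2U cT1 cT2 T12 hU ntU sD sG DG /crossP UG.
have [sT1 _] := hU _ T1U; have [sT2 _] := hU _ T2U.
pose S := T1 :&: T2; pose vs := enum S.
pose P := T1 :\: T2; pose P' := T2 :\: T1.
pose tau v := odflt set0 [pick X in U | v \notin X].
have tauP v : tau v \in U /\ v \notin tau v.
  rewrite /tau; case: pickP => [X /andP[]|] //= none.
  by have [X XU vX] := ntU v; have := none X; rewrite XU vX.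
have memvs v : (v \in vs) = (v \in S) by rewrite mem_enum.
have cS : #|S| < k - 1.
  rewrite ltn_neqAle -{2}cT1 subset_leq_card ?subsetIl // andbT.
  apply: contraNneq T12 => eS; rewrite eqEcard cT1 cT2 leqnn andbT.
  by apply/setIidPl/eqP; rewrite eqEcard subsetIl cT1 -eS leqnn.
have [|W /drawsP[sW cW] _] := @exists_draw _ set0 (Y :\: (T1 :|: T2)) #|S| (sub0set _).
  rewrite cards0 cardsD (setIidPr _) ?subUset ?sT1 // cardsU cT1 cT2 -/S.
  by move: cS leY lek; clear; lia.
move: sW; rewrite subsetD => /andP[sWY].
rewrite disjoint_sym disjointsUl => /andP[dWT1 dWT2].
pose T2' := P' :|: W.
have dT : [disjoint T1 & T2'].
  rewrite disjoint_sym disjointsUl [[disjoint W & _]]disjoint_sym dWT1 andbT.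
  by rewrite disjoints_subset subsetDr.
have sT2' : T2' \subset Y by rewrite subUset sWY andbT (subset_trans (subsetDl _ _)).
have cT2' : #|T2'| = k - 1.
  rewrite cardsU disjoint_setI0; last first.
    by rewrite (disjointWl (subsetDl _ _)).
  rewrite cards0 cW cardsD cT2 [T2 :&: T1]setIC -/S; move: cS; clear; lia.
have := @count_not_good _ tau Y P P' T2' set0 k (S != set0) vs lek sT2' cT2' leY
  (enum_uniq _).
rewrite setD0 disjoints_subset sub0set => /(_ isT) count.
have hvs : {in vs, forall v, [/\ v \in Y, v \notin (set0 : {set T}), v \notin T2',
    v \notin tau v & #|tau v| <= k - 1]}.
  move=> v; rewrite memvs => /setIP[vT1 vT2]; have [tU vt] := tauP v.
  have [_ /andP[_ ct]] := hU _ tU; rewrite inE (subsetP sT1) //; split=> //.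
  by rewrite (disjointFr dT vT1).
have base X' : X' = set0 :|: [set x in vs] ->
    #|[set E in draws (Y :\: X') k | (E :&: P == set0) || (E :&: T2' == set0)]|
      + (S != set0)
    <= #|[set E in draws (Y :\: X') k | ~~ good tau P P' [::] E]|.
  move=> ->; have -> : set0 :|: [set x in vs] = S.
    by apply/setP => x; rewrite set0U inE memvs.
  have sub : [set E in draws (Y :\: S) k | (E :&: P == set0) || (E :&: T2' == set0)]
      \subset [set E in draws (Y :\: S) k | ~~ good tau P P' [::] E].
    apply/subsetP => E /setIdP[Ed h]; apply/setIdP; split=> //=; rewrite negb_and !negbK.
    case/orP: h => [->|]; rewrite // setIUr setU_eq0 => /andP[-> _].
    by rewrite orbT.
  have [_|S0] := boolP (S == set0); first by rewrite addn0 subset_leq_card.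
  rewrite addn1; apply: proper_card; rewrite properE sub /=.
  (* The surplus set contains some [p] in [P] and [w] in [W] but avoids [T2]: it misses [P'], hence
     is not good, yet it meets [P] and [T2']. *)
  have /card_gt0P[p pP] : 0 < #|P|.
    by rewrite cardsD cT1 -/S subn_gt0.
  have /card_gt0P[w wW] : 0 < #|W| by rewrite cW card_gt0.
  have /setDP[pT1 pT2] := pP.
  have wT2 : w \notin T2 by rewrite (disjointFl dWT2).
  have [||E /drawsP[sE cE]] := @exists_draw _ [set p; w] (Y :\: T2) k.
  - by rewrite subUset !sub1set !inE pT2 wT2 (subsetP sT1) // (subsetP sWY).
  - rewrite cards2 cardsD (setIidPr sT2) cT2; move: leY lek; clear.
    by case: (_ != _); lia.
  rewrite subUset !sub1set => /andP[pE wE].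
  have dET2 : E :&: T2 = set0.
    by apply: disjoint_setI0; move: sE; rewrite subsetD => /andP[].
  apply/subsetPn; exists E.
    rewrite !inE cE eqxx andbT subsetD (subset_trans sE (subsetDl _ _)) /=.
    rewrite -setI_eq0 /S setIA [E :&: T1]setIC -setIA dET2 setI0 eqxx /=.
    have -> : E :&: P' = set0 by rewrite /P' setIDA dET2 set0D.
    by rewrite eqxx andbF.
  rewrite inE negb_and; apply/orP; right; rewrite negb_or; apply/andP; split.
    by apply/set0Pn; exists p; rewrite inE pE.
  by apply/set0Pn; exists w; rewrite !inE wE wW !orbT.
have {count hvs base} := count hvs base.
have -> : [set E in draws Y k | all (fun v => v \notin E) vs && (E :&: P == set0)
      || (E :&: T2' == set0)] =
    (* Avoiding the list, that is [S], together with [P] means avoiding [T1]. *)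
    [set E in draws Y k | (E :&: T1 == set0) || (E :&: T2' == set0)].
  apply/setP => E; rewrite !inE; congr (_ && (_ || _)).
  have -> : T1 = S :|: P by rewrite setID.
  rewrite setIUr setU_eq0; congr (_ && _); apply/allP/eqP => [h|h v].
    by apply/setP => x; rewrite in_set0 inE andbC -memvs; apply/negP => /andP[/h/negP].
  by rewrite memvs => vS; apply/negP => vE; have := in_setI v E S; rewrite h vE vS inE.
pose R := [set E in draws Y k | good tau P P' vs E].
pose exc := exceptional tau (k - 2) vs set0.
rewrite -/exc => count.
have sR : R \subset draws Y k by apply/subsetP => E /setIdP[].
have sGR : GG \subset R.
  apply/subsetP => E EG; rewrite inE (subsetP sG) //=; apply: goodI => [v _|h].
    by rewrite setIC; apply: UG => //; case: (tauP v).
  have h' x : x \in E -> x \in S -> false.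
    by move=> xE; rewrite -memvs => /h; rewrite xE.
  apply/andP; split.
    have /set0Pn[x /setIP[xT xE]] := UG _ _ T1U EG; apply/set0Pn; exists x.
    by rewrite !inE xE xT andbT; apply/negP => xT'; have := h' x xE; rewrite inE xT xT' => /(_ isT).
  have /set0Pn[x /setIP[xT xE]] := UG _ _ T2U EG; apply/set0Pn; exists x.
  by rewrite !inE xE xT andbT; apply/negP => xT'; have := h' x xE; rewrite inE xT xT' => /(_ isT).
pose DD' := [set D in DD | D \notin exc].
have hall : #|DD'| * ('C(#|Y| - k, k - 2) + 0) <= (#|R| - #|GG|) * 'C(#|Y| - k, k - 2).
  apply: pair_matching_le => //.
  - by apply: subset_trans sD; apply/subsetP => D /setIdP[].
  - by apply/crossP => D E /setIdP[DD_D _] EG; move/crossP: DG; apply.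
  move=> D /setIdP[/(subsetP sD) Dd Dexc]; have /drawsP[sDY cD] := Dd.
  have [|||||||p [q [pY qY pq g]]] := @good_pair _ tau Y P P' D set0 vs.
  - move=> v; rewrite memvs => /setIP[vT1 _]; have [tU vt] := tauP v.
    by have [st /andP[ct _]] := hU _ tU; rewrite (subsetP sT1) // cD.
  - exact: subset_trans (subsetDl _ _) sT1.
  - exact: subset_trans (subsetDl _ _) sT2.
  - by rewrite -setI_eq0; apply/eqP/setP => x; rewrite !inE; case: (x \in T1); rewrite ?andbF.
  - move=> _ svs; have sS : S \subset D by apply/subsetP => x; rewrite -memvs; apply: svs.
    have big (X : {set T}) : #|X| = k - 1 -> ~ X \subset D.
      by move=> cX /subset_leq_card; rewrite cX cD; move: lek; clear; lia.
    apply/andP; split; apply/negP => sPD.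
      by apply: (big T1 cT1); rewrite -(setID T1 T2) subUset sS.
    by apply: (big T2 cT2); rewrite -(setID T2 T1) subUset [T2 :&: T1]setIC sS.
  - exact: sub0set.
  - by rewrite cD.
  rewrite addn0 -(card_draws_pair lek Dd pY qY pq); apply/subset_leq_card/subsetP => E.
  rewrite !inE subUset !sub1set -andbA => /and4P[sE cE /andP[pE qE] dE].
  by rewrite sE cE disjoint_sym dE andbT; apply: g.
have cDD : #|DD| <= #|DD'| + size exc.
  rewrite (card_setId_split DD (fun D => D \notin exc)) leq_add2l.
  apply: leq_trans (card_size exc); apply/subset_leq_card/subsetP => D.
  by rewrite inE negbK => /andP[].
have hall' : #|DD'| <= #|R| - #|GG|.
  by move: hall; rewrite addn0 leq_pmul2r // bin_gt0; move: leY lek; clear; lia.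
have cGR := subset_leq_card sGR.
have cR : #|R| + #|[set E in draws Y k | ~~ good tau P P' vs E]| = 'C(#|Y|, k).
  by rewrite -card_draws [RHS](card_setId_split _ (good tau P P' vs)).
have cM := card_draws_meeting2C Y T1 T2' k.
have := card_draws_meeting2 k sT1 sT2' dT; rewrite cT1 cT2'.
have -> : k - 1 + (k - 1) = 2 * (k - 1) by clear; lia.
move: count cDD hall' cGR cR cM; rewrite -/S.
set x1 := #|DD|; set x2 := #|DD'|; set x3 := #|R|; set x4 := #|GG|.
clearbody x1 x2 x3 x4; case: (S != set0) => /=; clear; lia.
Qed.

Definition meeting2 (T : finType) (Y T1 T2 : {set T}) k : {set {set T}} :=
  [set E in draws Y k | (E :&: T1 != set0) && (E :&: T2 != set0)].

(** Each [D] is disjoint from all sets through a pair [p], [q] counted by [card_draws_pair], and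
    also from a further transversal [E1] not containing this pair. The resulting surplus of one
    makes the matching bound strict. *)
Lemma meeting2_lt (T : finType) (Y T1 T2 : {set T}) (DD GG : {set {set T}}) k :
  3 <= k -> 2 * k <= #|Y| + 1 -> T1 \subset Y -> T2 \subset Y ->
  #|T1| = k - 1 -> #|T2| = k - 1 -> [disjoint T1 & T2] ->
  DD \subset draws Y (k - 2) -> GG \subset meeting2 Y T1 T2 k -> cross DD GG ->
  DD != set0 -> #|DD| + #|GG| < #|meeting2 Y T1 T2 k|.
Proof.
move=> lek leY sT1 sT2 cT1 cT2 dT sD sG DG DD0.
have lek2 : 2 <= k by apply: ltnW.
have sR : meeting2 Y T1 T2 k \subset draws Y k by apply/subsetP => E /setIdP[].
suff deg D : D \in DD ->
    'C(#|Y| - k, k - 2) + 1 <= #|[set E in meeting2 Y T1 T2 k | [disjoint D & E]]|.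
  have := pair_matching_le sD sR sG DG deg; move: DD0; rewrite -card_gt0.
  move: (subset_leq_card sG); move: (#|DD|) (#|GG|) (#|meeting2 _ _ _ _|) ('C(_, _)).
  clear => d g r c ler d0 le1; rewrite addnC -ltn_subRL ltnNge; apply/negP => le2.
  by have := leq_trans le1 (leq_mul le2 (leqnn c)); rewrite mulnDr muln1; lia.
move=> /(subsetP sD) Dd; have /drawsP[sDY cD] := Dd.
have pick (A B : {set T}) : [disjoint A & B] -> A \subset Y -> B \subset Y ->
    1 < #|A :\: D| -> 0 < #|B :\: D| -> exists p q, exists2 E : {set T},
    [/\ p \in A :\: D, q \in B :\: D & p \notin E] &
    [/\ E \in draws Y k, [disjoint E & D], E :&: A != set0 & E :&: B != set0].
  move=> dAB sA sB /card_gt1P[p [p' [pA p'A pp']]] /card_gt0P[q qB].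
  have /setDP[pA' pD] := pA; have /setDP[p'A' p'D] := p'A; have /setDP[qB' qD] := qB.
  have pq : p != q by apply: contraTneq qB' => <-; rewrite (disjointFr dAB).
  have [||E /drawsP[sE cE]] := @exists_draw _ [set p'; q] (Y :\: (p |: D)) k.
  - rewrite subUset !sub1set !inE !negb_or p'D qD eq_sym pp' eq_sym pq.
    by rewrite (subsetP sA) // (subsetP sB).
  - rewrite cards2 cardsD (setIidPr _); last by rewrite subUset sub1set (subsetP sA).
    by rewrite cardsU1 pD cD; case: (_ != _); move: lek leY; clear; lia.
  rewrite subUset !sub1set => /andP[p'E qE].
  have := sE; rewrite subsetD disjoint_sym disjointsUl disjoints1 => /and3P[sEY pE dE].
  exists p, q; exists E => //; split; first by apply/drawsP.
  - by rewrite disjoint_sym.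
  - by apply/set0Pn; exists p'; rewrite inE p'E.
  - by apply/set0Pn; exists q; rewrite inE qE.
have c1 : k - 1 <= #|T1 :\: D| + #|T1 :&: D| by rewrite addnC cardsID cT1.
have c2 : k - 1 <= #|T2 :\: D| + #|T2 :&: D| by rewrite addnC cardsID cT2.
have c12 : #|T1 :&: D| + #|T2 :&: D| <= k - 2.
  rewrite -cD; have <- : #|(T1 :&: D) :|: (T2 :&: D)| = #|T1 :&: D| + #|T2 :&: D|.
    by rewrite cardsU setIACA (disjoint_setI0 dT) set0I cards0 subn0.
  by rewrite -setIUl subset_leq_card ?subsetIr.
(* As |D| = k - 2, both [T1] and [T2] keep a point outside [D], and together they keep at least k >=
   3, so one of them keeps two: one for the pair, another for [E1]. *)
have [p [q [E1 [pT1 qT2 nE1] [E1d dE1 E1T1 E1T2]]]] : exists p q, exists2 E : {set T},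
    [/\ p \in T1 :\: D, q \in T2 :\: D & ~~ ([set p; q] \subset E)] &
    [/\ E \in draws Y k, [disjoint E & D], E :&: T1 != set0 & E :&: T2 != set0].
  have [lt1|le1] := ltnP 1 #|T1 :\: D|.
    have [|p [q [E [h1 h2 h3] h4]]] := pick T1 T2 dT sT1 sT2 lt1.
      by move: c1 c2 c12 lek; clear; lia.
    by exists p, q; exists E => //; split=> //; rewrite subUset sub1set (negPf h3).
  have [|||p [q [E [h1 h2 h3] [h4 h5 h6 h7]]]] := pick T2 T1 _ sT2 sT1.
  - by rewrite disjoint_sym.
  - by move: c1 c2 c12 lek le1; clear; lia.
  - by move: c1 c2 c12 lek le1; clear; lia.
  exists q, p; exists E => //; split=> //.
  by rewrite subUset !sub1set (negPf h3) andbF.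
have pq : p != q.
  have /setDP[pT _] := pT1; have /setDP[qT _] := qT2.
  by apply: contraTneq qT => <-; rewrite (disjointFr dT).
have pY : p \in Y :\: D by apply: subsetP pT1; apply: setSD.
have qY : q \in Y :\: D by apply: subsetP qT2; apply: setSD.
rewrite -(card_draws_pair lek2 Dd pY qY pq) addn1.
set Q := [set E in draws Y k | _].
have <- : #|E1 |: Q| = #|Q|.+1.
  by rewrite cardsU1 2!inE negb_and (negPf nE1) orbT.
apply/subset_leq_card/subsetP => E /setU1P[->|].
  by rewrite inE inE E1d E1T1 E1T2 disjoint_sym.
case/setIdP=> Ed /andP[]; rewrite subUset !sub1set => /andP[pE qE] dED.
rewrite inE inE Ed disjoint_sym dED andbT /=.
have /setDP[pT _] := pT1; have /setDP[qT _] := qT2.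
by apply/andP; split; apply/set0Pn; [exists p|exists q]; rewrite inE ?pE ?qE.
Qed.

(** * Traces on the complement of a pair *)

(** For [V] inside [c], these are the traces outside [c] of the members of [F] that meet [c] exactly
    in [V]. *)
Definition link (T : finType) (F : {set {set T}}) (c V : {set T}) : {set {set T}} :=
  [set X : {set T} | [disjoint X & c] && (V :|: X \in F)].

Lemma link_draws (T : finType) (F : {set {set T}}) (c V : {set T}) k :
  V \subset c -> F \subset draws setT k -> link F c V \subset draws (~: c) (k - #|V|).
Proof.
move=> sV sF; apply/subsetP => X; rewrite inE => /andP[dX XF].
have /drawsP[_ cX] := subsetP sF _ XF; apply/drawsP; split.
  by rewrite -disjoints_subset.
rewrite -cX cardsU setIC disjoint_setI0 ?cards0 ?subn0 ?addKn //.
exact: disjointWr dX.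
Qed.

Lemma link_cross (T : finType) (F G : {set {set T}}) (c V V' : {set T}) :
  V \subset c -> V' \subset c -> [disjoint V & V'] -> cross F G ->
  cross (link F c V) (link G c V').
Proof.
move=> sV sV' dV /crossP FG; apply/crossP => X X'; rewrite !inE.
case/andP=> dX XF /andP[dX' XG]; have := FG _ _ XF XG.
rewrite setIUl !setIUr (disjoint_setI0 dV) set0U.
have -> : V :&: X' = set0.
  by rewrite setIC; apply: disjoint_setI0; apply: disjointWr dX'.
have -> : X :&: V' = set0 by apply: disjoint_setI0; apply: disjointWr dX.
by rewrite !set0U.
Qed.

Lemma card_link (T : finType) (F : {set {set T}}) (c V : {set T}) :
  V \subset c -> #|link F c V| = #|[set A in F | A :&: c == V]|.
Proof.
move=> sV; rewrite -[LHS](card_in_imset (f := fun X => V :|: X)).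
  apply: eq_card => A; rewrite inE; apply/imsetP/andP.
    case=> X; rewrite inE => /andP[dX XF] ->; split=> //.
    by rewrite setIUl (disjoint_setI0 dX) setU0; apply/eqP/setIidPl.
  case=> AF /eqP AV; exists (A :\: c); last by rewrite -AV setID.
  by rewrite inE -AV setID AF andbT disjoints_subset subsetDr.
move=> X X'; rewrite !inE => /andP[dX _] /andP[dX' _] /(congr1 (fun Z => Z :\: c)).
by rewrite !setDUl (eqP (_ : V :\: c == set0)) ?setD_eq0 // !set0U !(setDidPl _).
Qed.

Lemma mem_link (T : finType) (F : {set {set T}}) (c V A : {set T}) :
  A \in F -> A :&: c = V -> A :\: c \in link F c V.
Proof.
by move=> AF <-; rewrite inE setID AF andbT disjoints_subset subsetDr.
Qed.

Lemma setI_pair (T : finType) (A : {set T}) x y :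
  A :&: [set x; y] =
  (if x \in A then [set x] else set0) :|: (if y \in A then [set y] else set0).
Proof.
rewrite setIUr; congr (_ :|: _); apply/setP => z; rewrite !inE.
  by case: (z =P x) => [->|]; case: (x \in A); rewrite !inE ?eqxx ?andbF //; case: eqP.
by case: (z =P y) => [->|]; case: (y \in A); rewrite !inE ?eqxx ?andbF //; case: eqP.
Qed.

Lemma card_links (T : finType) (F : {set {set T}}) x y : x != y ->
  #|F| = #|link F [set x; y] [set x]| + #|link F [set x; y] [set y]|
    + #|link F [set x; y] [set x; y]| + #|link F [set x; y] set0|.
Proof.
move=> xy; rewrite !card_link ?sub0set ?sub1set ?inE ?eqxx ?orbT ?subxx //.
rewrite [LHS](card_setId_split _ (fun A : {set T} => x \in A)).
rewrite [#|[set A in F | x \in A]|](card_setId_split _ (fun A : {set T} => y \in A)).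
rewrite [#|[set A in F | x \notin A]|](card_setId_split _ (fun A : {set T} => y \in A)).
have eqf (V : {set T}) b1 b2 : V = (if b1 then [set x] else set0) :|: (if b2 then [set y] else set0) ->
    #|[set A in F | A :&: [set x; y] == V]| =
    #|[set A in F | ((x \in A) == b1) && ((y \in A) == b2)]|.
  move=> ->; apply: eq_card => A; rewrite !inE; congr (_ && _); rewrite setI_pair.
  apply/eqP/andP => [/setP h|[/eqP-> /eqP->]] //.
  have hx := h x; have hy := h y; move: {h} hx hy.
  by case: (x \in A); case: (y \in A); case: b1; case: b2; rewrite !inE ?eqxx ?[y == x]eq_sym ?(negPf xy).
rewrite (eqf _ true false) ?setU0 // (eqf _ false true) ?set0U //.
rewrite (eqf _ true true) // (eqf _ false false) ?setU0 //.
set a := #|_|; set b := #|_|; set c := #|_|; set d := #|_|.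
have -> : a = #|[set A in F | (x \in A) == true & (y \in A) == true]|.
  by apply: eq_card => A; rewrite !inE !eqb_id andbA.
have -> : b = #|[set A in F | (x \in A) == true & (y \in A) == false]|.
  by apply: eq_card => A; rewrite !inE eqb_id eqbF_neg andbA.
have -> : c = #|[set A in F | (x \in A) == false & (y \in A) == true]|.
  by apply: eq_card => A; rewrite !inE eqb_id eqbF_neg andbA.
have -> : d = #|[set A in F | (x \in A) == false & (y \in A) == false]|.
  by apply: eq_card => A; rewrite !inE !eqbF_neg andbA.
clear; lia.
Qed.

(** * Non-trivial cross-intersecting pairs *)

(** Boolean form of [nontrivial]; over a non-empty ground set it also excludes the empty family. *)
Definition fixfree (T : finType) (F : {set {set T}}) : bool :=
  [forall v, exists A in F, v \notin A].

Lemma fixfreeP (T : finType) (F : {set {set T}}) :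
  reflect (forall v, exists2 A, A \in F & v \notin A) (fixfree F).
Proof. by apply: (iffP forallP) => h v; apply/exists_inP; apply: h. Qed.

Definition admissible (T : finType) k (F G : {set {set T}}) : bool :=
  [&& F \subset draws setT k, G \subset draws setT k, fixfree F, fixfree G & cross F G].

Lemma admissibleC (T : finType) k (F G : {set {set T}}) :
  admissible k F G = admissible k G F.
Proof.
by rewrite /admissible crossC; case: (F \subset _); case: (G \subset _);
  case: (fixfree F); case: (fixfree G).
Qed.

(** Pascal's rule for two points and for one point: it reassembles the bounds on traces, which live
    on n - 2 points, into the formula on [n] points. *)
Lemma bin_formula_split n k : 2 <= k -> 2 * k < n ->
  'C(n - 2, k - 2) + 2 * 'C(n - 2, k - 1) + 'C(n - 2, k) = 'C(n, k) /\
  'C(n - 2 - (k - 1), k - 1) + 'C(n - 2 - (k - 1), k) = 'C(n - k, k).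
Proof.
move=> lek lekn; split.
  have [m ->] : exists m, n = m.+2 by exists (n - 2); lia.
  have [j ->] : exists j, k = j.+2 by exists (k - 2); lia.
  by rewrite !subSS !subn0 !binS; lia.
have -> : n - k = (n - 2 - (k - 1)).+1 by lia.
have [j ->] : exists j, k = j.+1 by exists (k - 1); lia.
by rewrite binS subn1 /= addnC.
Qed.

Lemma add_member_maximal (T : finType) k (F G : {set {set T}}) (A : {set T}) :
  admissible k F G -> (forall F', admissible k F' G -> #|F'| <= #|F|) ->
  #|A| = k -> {in G, forall B : {set T}, A :&: B != set0} -> A \in F.
Proof.
case/and5P=> sF sG ntF ntG FG maxF cA AG; apply/negPn/negP => AF.
suff /maxF : admissible k (A |: F) G by rewrite cardsU1 AF ltnn.
apply/and5P; split=> //.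
- rewrite subUset sF andbT sub1set; apply/drawsP; split=> //; exact: subsetT.
- apply/fixfreeP => v; have [B BF vB] := fixfreeP _ ntF v.
  by exists B => //; rewrite inE BF orbT.
- by apply/crossP => B C /setU1P[->|BF] CG; [apply: AG | move/crossP: FG; apply].
Qed.

(** Otherwise every member of [G] containing [y] also contains [x], so the exchanged set still meets
    all of [G] and belongs to [F] by maximality. *)
Lemma blocked_opposite (T : finType) k (F G : {set {set T}}) x y (A : {set T}) :
  admissible k F G -> (forall F', admissible k F' G -> #|F'| <= #|F|) ->
  A \in F -> y \in A -> x \notin A -> x |: A :\ y \notin F ->
  exists2 B : {set T}, B \in G & (y \in B) && (x \notin B).
Proof.
move=> adm maxF AF yA xA nA; apply/exists_inP; apply: contraR nA => noB.
have /and5P[sF _ _ _ /crossP FG] := adm; have /drawsP[_ cA] := subsetP sF _ AF.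
apply: (add_member_maximal adm maxF).
  by rewrite cardsU1 !inE negb_and xA orbT -cA (cardsD1 y A) yA.
move=> B BG; have /set0Pn[z /setIP[zA zB]] := FG _ _ AF BG; apply/set0Pn.
have [xB|xB] := boolP (x \in B); first by exists x; rewrite !inE eqxx.
have [zy|zy] := eqVneq z y; last by exists z; rewrite !inE zy zA zB orbT.
by case/negP: noB; apply/exists_inP; exists B; rewrite // -zy zB xB.
Qed.

(** The bound is the sum of four: one for each of the pairs ([Fx], [Gy]) and ([Fy], [Gx]), the
    transversal bound for [Fxy] and [G0], and the trivial one for [Gxy]. No member of [F] avoids
    both [x] and [y]. *)
Lemma blocked_case (T : finType) k (F G : {set {set T}}) x y :
  2 <= k -> 2 * k < #|T| -> x != y ->
  admissible k F G -> (forall F', admissible k F' G -> #|F'| <= #|F|) ->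
  {in F, forall A : {set T}, (x \in A) || (y \in A)} ->
  (forall A : {set T}, A \in F -> y \in A -> x \notin A -> x |: A :\ y \notin F) ->
  #|F| + #|G| + 2 * 'C(#|T| - k, k) <= 2 + 'C(#|T|, k) + 'C(#|T| - 2 * k, k) /\
  (3 <= k ->
   #|F| + #|G| + 2 * 'C(#|T| - k, k) = 2 + 'C(#|T|, k) + 'C(#|T| - 2 * k, k) ->
   #|F| = 2).
Proof.
move=> lek lekn xy adm maxF hit nswap.
have /and5P[sF sG ntF ntG FG] := adm.
pose c := [set x; y]; pose Y := ~: c.
have sx : [set x] \subset c by rewrite sub1set !inE eqxx.
have sy : [set y] \subset c by rewrite sub1set !inE eqxx orbT.
have s0 : set0 \subset c := sub0set c.
have cY : #|Y| = #|T| - 2 by rewrite cardsCs setCK cards2 xy.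
pose Fx := link F c [set x]; pose Fy := link F c [set y]; pose Fxy := link F c c.
pose Gx := link G c [set x]; pose Gy := link G c [set y]; pose Gxy := link G c c.
pose G0 := link G c set0.
have dFx : Fx \subset draws Y (k - 1) by have := link_draws sx sF; rewrite cards1.
have dFy : Fy \subset draws Y (k - 1) by have := link_draws sy sF; rewrite cards1.
have dGx : Gx \subset draws Y (k - 1) by have := link_draws sx sG; rewrite cards1.
have dGy : Gy \subset draws Y (k - 1) by have := link_draws sy sG; rewrite cards1.
have cc : #|c| = 2 by rewrite cards2 xy.
have dFxy : Fxy \subset draws Y (k - 2) by have := link_draws (subxx c) sF; rewrite cc.
have dGxy : Gxy \subset draws Y (k - 2) by have := link_draws (subxx c) sG; rewrite cc.
have dG0 : G0 \subset draws Y k by have := link_draws s0 sG; rewrite cards0 subn0.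
have Ix (A : {set T}) : x \in A -> y \notin A -> A :&: c = [set x].
  by move=> xA yA; rewrite setI_pair xA (negPf yA) setU0.
have Iy (A : {set T}) : y \in A -> x \notin A -> A :&: c = [set y].
  by move=> yA xA; rewrite setI_pair yA (negPf xA) set0U.
have [Ax AxF yAx] := fixfreeP _ ntF y; have [Ay AyF xAy] := fixfreeP _ ntF x.
have xAx : x \in Ax by have := hit _ AxF; rewrite (negPf yAx) orbF.
have yAy : y \in Ay by have := hit _ AyF; rewrite (negPf xAy).
have Fx0 : Fx != set0 by apply/set0Pn; exists (Ax :\: c); apply: mem_link; auto.
have Fy0 : Fy != set0 by apply/set0Pn; exists (Ay :\: c); apply: mem_link; auto.
have Gy0 : Gy != set0.
  have [B BG /andP[yB xB]] := blocked_opposite adm maxF AyF yAy xAy (nswap _ AyF yAy xAy).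
  by apply/set0Pn; exists (B :\: c); apply: mem_link; auto.
have Gx0 : Gx != set0.
  (* The hypothesis also forbids the reverse exchange: otherwise exchanging back would give [Ax], a
     member of [F]. *)
  have nAx : y |: Ax :\ x \notin F.
    apply/negP => AF; have := nswap _ AF; rewrite !inE !eqxx (negPf xy) /=.
    move=> /(_ isT isT); rewrite setU1K ?setD1K ?AxF // !inE (negPf yAx) andbF //.
  have [B BG /andP[xB yB]] := blocked_opposite adm maxF AxF xAx yAx nAx.
  by apply/set0Pn; exists (B :\: c); apply: mem_link; auto.
have HM1 : #|Fx| + #|Gy| + 'C(#|Y| - (k - 1), k - 1) <= 'C(#|Y|, k - 1) + 1.
  apply: cross_nonempty_le => //.
    by apply: link_cross => //; rewrite disjoints1 inE.
  by rewrite cY; move: lek lekn; clear; lia.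
have HM2 : #|Fy| + #|Gx| + 'C(#|Y| - (k - 1), k - 1) <= 'C(#|Y|, k - 1) + 1.
  apply: cross_nonempty_le => //.
    by apply: link_cross => //; rewrite disjoints1 inE eq_sym.
  by rewrite cY; move: lek lekn; clear; lia.
have cGxy : #|Gxy| <= 'C(#|Y|, k - 2) by rewrite -card_draws subset_leq_card.
have leY : 2 * k <= #|Y| + 1 by rewrite cY; move: lek lekn; clear; lia.
have Fxy_G0 : cross Fxy G0 by apply: link_cross => //; rewrite disjoint_sym disjoints_subset sub0set.
have Fx_G0 : cross Fx G0 by apply: link_cross => //; rewrite disjoint_sym disjoints_subset sub0set.
have Fy_G0 : cross Fy G0 by apply: link_cross => //; rewrite disjoint_sym disjoints_subset sub0set.
have ntU v : exists2 X, X \in Fx :|: Fy :|: Fxy & v \notin X.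
  have [A AF vA] := fixfreeP _ ntF v; exists (A :\: c); last first.
    by rewrite inE (negPf vA) andbF.
  have := hit _ AF; rewrite !in_setU.
  have [xA|xA] := boolP (x \in A); have [yA|yA] := boolP (y \in A) => // _.
  - by apply/orP; right; apply: mem_link => //; rewrite setI_pair xA yA.
  - by rewrite mem_link //; auto.
  - by rewrite [X in _ || X || _]mem_link ?orbT //; auto.
have hU : {in Fx :|: Fy :|: Fxy, forall X : {set T}, X \subset Y /\ k - 2 <= #|X| <= k - 1}.
  move=> X; rewrite !in_setU -orbA => /or3P[/(subsetP dFx)|/(subsetP dFy)|/(subsetP dFxy)];
    move=> /drawsP[sX ->]; by split=> //; move: lek; clear; lia.
have UG0 : cross (Fx :|: Fy :|: Fxy) G0.
  apply/crossP => A B; rewrite !in_setU -orbA => /or3P[] h BG.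
  - by move/crossP: Fx_G0; apply.
  - by move/crossP: Fy_G0; apply.
  - by move/crossP: Fxy_G0; apply.
have trans T1 T2 : T1 \in Fx -> T2 \in Fy -> #|Fxy| + #|G0| + (T1 :&: T2 != set0)
    + 2 * 'C(#|Y| - (k - 1), k) <= 'C(#|Y|, k) + 'C(#|Y| - 2 * (k - 1), k).
  move=> T1x T2y; have /drawsP[_ c1] := subsetP dFx _ T1x.
  have /drawsP[_ c2] := subsetP dFy _ T2y.
  apply: (transversal_le lek leY _ _ c1 c2 _ hU ntU dFxy dG0 Fxy_G0 UG0).
  - by rewrite !in_setU T1x.
  - by rewrite !in_setU T2y orbT.
  apply/eqP => eT; move: T1x T2y; rewrite -eT !inE => /andP[dT xT] /andP[_ yT].
  have xnT : x \notin T1 by rewrite (disjointFl dT) // !inE eqxx.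
  have ynT : y \notin T1 by rewrite (disjointFl dT) // !inE eqxx orbT.
  have := nswap _ yT; rewrite setU1K // xT !inE eqxx (negPf xy) (negPf xnT).
  by move=> /(_ isT isT).
have F00 : #|link F c set0| = 0.
  apply/eqP; rewrite cards_eq0; apply/eqP/setP => X; rewrite [RHS]inE; apply/negP.
  rewrite inE set0U => /andP[dX XF]; have := hit _ XF.
  by rewrite !(disjointFl dX) // !inE eqxx ?orbT.
have cF := card_links F xy; have cG := card_links G xy.
rewrite -/c -/Fx -/Fy -/Fxy F00 in cF; rewrite -/c -/Gx -/Gy -/Gxy -/G0 in cG.
have [bin1 bin2] := bin_formula_split lek lekn.
have e2k : #|T| - 2 - 2 * (k - 1) = #|T| - 2 * k by move: lek lekn; clear; lia.
rewrite cY in HM1 HM2 cGxy trans; rewrite e2k in trans.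
have [X1 X1F] := set0Pn _ Fx0; have [X2 X2F] := set0Pn _ Fy0.
split.
  have := trans _ _ X1F X2F; move: HM1 HM2 cGxy cF cG bin1 bin2; clear.
  by move: (_ != _) => b; lia.
move=> lek3 eqsum.
(* Equality in the sum leaves no slack in the transversal bound. Hence every [T1] in [Fx] is
   disjoint from every [T2] in [Fy], [Fxy] is empty and [G0] contains all transversals. *)
have tight : 'C(#|T| - 2, k) + 'C(#|T| - 2 * k, k) <=
    #|Fxy| + #|G0| + 2 * 'C(#|T| - 2 - (k - 1), k).
  by move: HM1 HM2 cGxy cF cG bin1 bin2 eqsum; clear; lia.
have disj T1 T2 : T1 \in Fx -> T2 \in Fy -> [disjoint T1 & T2].
  move=> h1 h2; rewrite -setI_eq0; apply/negPn/negP => n0.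
  by have := trans _ _ h1 h2; move: tight; rewrite n0; clear; lia.
have full T1 T2 : T1 \in Fx -> T2 \in Fy -> Fxy = set0 /\ G0 = meeting2 Y T1 T2 k.
  move=> h1 h2; have d12 := disj _ _ h1 h2.
  have /drawsP[s1 c1] := subsetP dFx _ h1; have /drawsP[s2 c2] := subsetP dFy _ h2.
  have sub : G0 \subset meeting2 Y T1 T2 k.
    apply/subsetP => E EG; rewrite inE (subsetP dG0) //= ![E :&: _]setIC.
    by move/crossP: UG0 => UG; rewrite !UG // !in_setU ?h1 ?h2 ?orbT.
  have cM := card_draws_meeting2 k s1 s2 d12.
  rewrite c1 c2 addnn -mul2n cY e2k -/(meeting2 Y T1 T2 k) in cM.
  have Fxy0 : Fxy = set0.
    apply/eqP/negPn/negP => n0.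
    have := meeting2_lt lek3 leY s1 s2 c1 c2 d12 dFxy sub Fxy_G0 n0.
    by move: cM tight; clear; lia.
  split=> //; apply/eqP; rewrite eqEcard sub /=.
  have arith m g b X : m + b + b = X -> X <= 0 + g + 2 * b -> m <= g by clear; lia.
  by move: cM tight; rewrite Fxy0 cards0; apply: arith.
(* The transversals of [T1] and [T2] determine [T1]: if some [p] of [T1] were outside [T1'], a set
   through [p] and a point of [T2] could avoid [T1']. *)
have single (T1 T1' T2 : {set T}) : T1 \subset Y -> T2 \subset Y ->
    #|T1| = k - 1 -> #|T1'| = k - 1 -> #|T2| = k - 1 -> T1' \subset Y ->
    [disjoint T1' & T2] -> {in meeting2 Y T1 T2 k, forall E : {set T}, T1' :&: E != set0} -> T1 = T1'.
  move=> s1 s2 c1 c1' c2 s1' d12 h; apply/eqP; rewrite eqEcard c1 c1' leqnn andbT.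
  apply/negPn/negP => /subsetPn[p pT1 pT1'].
  have /card_gt0P[q qT2] : 0 < #|T2| by rewrite c2; move: lek; clear; lia.
  have [||E /drawsP[sE cE]] := @exists_draw _ [set p; q] (Y :\: T1') k.
  - rewrite subUset !sub1set !inE pT1' (disjointFl d12) //=.
    by have := subsetP s1 _ pT1; have := subsetP s2 _ qT2; rewrite !inE => -> ->.
  - rewrite cards2 cardsD (setIidPr s1') c1'; move: leY lek; clear.
    by case: (_ != _); lia.
  rewrite subUset !sub1set => /andP[pE qE].
  have := sE; rewrite subsetD => /andP[sEY dE].
  suff /h : E \in meeting2 Y T1 T2 k by rewrite setI_eq0 disjoint_sym dE.
  rewrite inE; apply/and3P; split; first by apply/drawsP.
    by apply/set0Pn; exists p; rewrite inE pE.
  by apply/set0Pn; exists q; rewrite inE qE.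
have [Fxy0 _] := full _ _ X1F X2F.
have /drawsP[sX1 cX1] := subsetP dFx _ X1F; have /drawsP[sX2 cX2] := subsetP dFy _ X2F.
have Fx1 : Fx = [set X1].
  apply/setP => X; rewrite in_set1; apply/idP/eqP => [XF|->] //.
  have /drawsP[sX cX] := subsetP dFx _ XF.
  apply: (single X X1 X2) => //; first exact: disj.
  by have [_ <-] := full _ _ XF X2F; move=> E EG; move/crossP: Fx_G0; apply.
have Fy1 : Fy = [set X2].
  apply/setP => X; rewrite in_set1; apply/idP/eqP => [XF|->] //.
  have /drawsP[sX cX] := subsetP dFy _ XF.
  apply: (single X X2 X1) => //; first by rewrite disjoint_sym; exact: disj.
  have [_ eG] := full _ _ X1F XF; move=> E; rewrite inE [_ && (_ != _)]andbC => EG.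
  by move/crossP: Fy_G0; apply=> //; rewrite eG inE.
by rewrite cF Fxy0 Fx1 Fy1 !cards1 cards0.
Qed.

(** * Families pushed into a core of size k + 1 *)

(** By Pascal's rule, C(N, k) - C(N - j, k) is the sum of the C(N - i, k - 1) for 1 <= i <= j. Each
    term is at most C(N, k - 1) - 1, and from i = 2 on at most C(N, k - 1) - 2. *)
Lemma bin_telescope_le N k j : 2 <= k -> k <= N -> j < k ->
  'C(N, k) + j + (1 < j) <= 'C(N - j, k) + j * 'C(N, k - 1).
Proof.
move=> lek lekN; elim: j => [|j IH] ltjk; first by rewrite subn0 mul0n !addn0.
have {}IH := IH (ltnW ltjk).
have [k' ek] : exists k', k = k'.+2 by exists (k - 2); lia.
have [N' eN] : exists N', N = N'.+2 by exists (N - 2); lia.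
have e1 : 'C(N - j, k) = 'C(N - j.+1, k) + 'C(N - j.+1, k - 1).
  have -> : N - j = (N - j.+1).+1 by lia.
  by rewrite ek binS subn1.
have e2 : 'C(N, k - 1) = 'C(N'.+1, k'.+1) + 'C(N'.+1, k') by rewrite eN ek subn1 binS.
have p1 : 0 < 'C(N'.+1, k') by rewrite bin_gt0; lia.
have p2 : 0 < 'C(N', k') by rewrite bin_gt0; lia.
have e3 : 'C(N'.+1, k'.+1) = 'C(N', k'.+1) + 'C(N', k') by rewrite binS.
have le1 : 'C(N - j.+1, k - 1) + 1 + (0 < j) <= 'C(N, k - 1).
  case: j {IH e1} ltjk => [|j] ltjk; rewrite e2.
    have -> : N - 1 = N'.+1 by lia.
    have -> : k - 1 = k'.+1 by lia.
    by rewrite /=; lia.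
  have : 'C(N - j.+2, k - 1) <= 'C(N', k'.+1).
    by rewrite ek subn1 leq_bin2l //; lia.
  by rewrite /=; lia.
by case: j IH e1 le1 ltjk => [|[|j]] IH e1 le1 ltjk; rewrite /= in IH le1 *; nia.
Qed.

(** The telescoped bound is applied with N = n - k - 1 and j = k - 1, so that N - j = n - 2k. Its
    extra unit becomes the term [2 < k], which rules out equality in the core case for k >= 3. *)
Lemma core_formula_le n k s : 2 <= k -> 2 * k < n ->
  s + 'C(n - k.+1, k) + k.+1 * 'C(n - k.+1, k - 1) <= 'C(n, k) + k.+1 ->
  s + 2 * 'C(n - k, k) + (2 < k) <= 2 + 'C(n, k) + 'C(n - 2 * k, k).
Proof.
move=> lek lekn h.
have lekN : k <= n - k.+1 by lia.
have ltk : k - 1 < k by lia.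
have := bin_telescope_le lek lekN ltk.
have -> : n - k.+1 - (k - 1) = n - 2 * k by lia.
have -> : 'C(n - k, k) = 'C(n - k.+1, k) + 'C(n - k.+1, k - 1).
  have -> : n - k = (n - k.+1).+1 by lia.
  by have [j ->] : exists j, k = j.+1 by [exists (k - 1); lia]; rewrite binS subn1.
have -> : (1 < k - 1) = (2 < k) by lia.
have e : k.+1 * 'C(n - k.+1, k - 1) = (k - 1) * 'C(n - k.+1, k - 1) + 2 * 'C(n - k.+1, k - 1).
  by rewrite -mulnDl; congr (_ * _); lia.
move: h; rewrite e; lia.
Qed.

(** For [v] in [K], a member avoiding [v] can be pushed to [K :\ v], so both families contain all
    [k]-subsets of [K]. A set meeting [K] in at most the point [v] would miss [K :\ v]; hence only
    intersection sizes 2 to [k] occur, and size [k] only for the k + 1 subsets of [K]. *)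
Lemma core_case (T : finType) (K : {set T}) (F G : {set {set T}}) k :
  2 <= k -> 2 * k < #|T| -> #|K| = k.+1 -> admissible k F G ->
  pushed_into K F -> pushed_into K G ->
  #|F| + #|G| + 2 * 'C(#|T| - k, k) + (2 < k)
    <= 2 + 'C(#|T|, k) + 'C(#|T| - 2 * k, k).
Proof.
move=> lek lekn cK /and5P[sF sG ntF ntG FG] pF pG.
have full (H : {set {set T}}) v : H \subset draws setT k -> fixfree H ->
    pushed_into K H -> v \in K -> K :\ v \in H.
  move=> sH ntH pH vK; have [A AH vA] := fixfreeP _ ntH v.
  have /drawsP[_ cA] := subsetP sH _ AH.
  apply: (pushed_into_core pH AH); first exact: subsetDl.
    by have := cardsD1 v K; rewrite vK cK cA; clear; lia.
  by apply/subsetP => x /setIP[xA xK]; rewrite !inE xK andbT; apply: contraNneq vA => <-.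
have two (H H' : {set {set T}}) A : H' \subset draws setT k -> fixfree H' ->
    pushed_into K H' -> cross H H' -> A \in H -> 1 < #|A :&: K|.
  move=> sH ntH pH /crossP HH AH; rewrite ltnNge; apply/negP => le1.
  have [v vK sv] : exists2 v, v \in K & A :&: K \subset [set v].
    have [E0|/set0Pn[v vAK]] := eqVneq (A :&: K) set0.
      have /card_gt0P[v vK] : 0 < #|K| by rewrite cK.
      by exists v; rewrite // E0 sub0set.
    exists v; first by have /setIP[] := vAK.
    apply/subsetP => x xAK; rewrite inE; apply/eqP.
    by move/card_le1_eqP: le1; apply.
  have /set0Pn[x /setIP[xA]] := HH _ _ AH (full _ _ sH ntH pH vK).
  rewrite !inE => /andP[xv xK]; case/negP: xv.
  by rewrite -in_set1; apply: (subsetP sv); rewrite inE xA.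
have cb (H : {set {set T}}) : H \subset draws setT k ->
    (forall A, A \in H -> 1 < #|A :&: K|) -> #|H| <= #|band K H 2 k.-1| + k.+1.
  move=> sH h; rewrite (card_setId_split H (fun A : {set T} => #|A :&: K| <= k.-1)).
  apply: leq_add.
    by apply/subset_leq_card/subsetP => A /setIdP[AH ?]; rewrite inE AH h.
  have <- : #|draws K k| = k.+1 by rewrite card_draws cK binSn.
  apply/subset_leq_card/subsetP => A /setIdP[AH ltA].
  have /drawsP[_ cA] := subsetP sH _ AH; rewrite inE cA eqxx andbT.
  apply/setIidPl/eqP; rewrite eqEcard subsetIl cA; move: ltA lek; clear; lia.
have cF := cb _ sF (fun A => two F G A sG ntG pG FG).
have GF : cross G F by rewrite crossC.
have cG := cb _ sG (fun A => two G F A sF ntF pF GF).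
(* The choice |K| = k + 1 makes the band symmetric: 2 + (k - 1) = |K|. *)
have leB : #|band K F 2 k.-1| + #|band K G 2 k.-1| <= #|band K (draws setT k) 2 k.-1|.
  apply: core_band_le; rewrite ?subsetT ?cardsT ?leq_pred //; last exact: ltnW.
  by rewrite cK; move: lek; clear; lia.
have q0 : #|stratum setT K k 0| = 'C(#|T| - k.+1, k).
  by rewrite card_stratum ?subsetT // cardsT cK bin0 mul1n subn0.
have q1 : #|stratum setT K k 1| = k.+1 * 'C(#|T| - k.+1, k - 1).
  by rewrite card_stratum ?subsetT ?cardsT ?cK ?bin1 // ltnW.
have cD : #|draws K k| = k.+1 by rewrite card_draws cK binSn.
have tot : #|band K (draws setT k) 2 k.-1| + 'C(#|T| - k.+1, k)
    + k.+1 * 'C(#|T| - k.+1, k - 1) + k.+1 <= 'C(#|T|, k).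
  have -> : 'C(#|T|, k) = #|draws [set: T] k| by rewrite card_draws cardsT.
  rewrite (card_setId_split (draws _ _) (fun A : {set T} => 2 <= #|A :&: K| <= k.-1)).
  rewrite -q0 -q1 -!addnA leq_add //.
  rewrite [X in _ <= X](card_setId_split _ (fun A : {set T} => #|A :&: K| == 0)).
  apply: leq_add.
    apply/subset_leq_card/subsetP => A /stratumP[_ cA tA].
    by rewrite !inE subsetT cA tA !eqxx.
  rewrite [X in _ <= X](card_setId_split _ (fun A : {set T} => #|A :&: K| == 1)).
  apply: leq_add.
    apply/subset_leq_card/subsetP => A /stratumP[_ cA tA].
    by rewrite !inE subsetT cA tA !eqxx.
  rewrite -[X in X <= _]cD; apply/subset_leq_card/subsetP => A /drawsP[sA cA].
  rewrite !inE subsetT cA (setIidPl sA) cA eqxx /=; move: lek; clear; lia.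
apply: core_formula_le => //.
move: cF cG leB tot; clear; lia.
Qed.

(** * Bound and equality for maximal pairs *)

(** A point common to all compressed sets must be [w], since some member of [F] avoids it and only
    [w] is ever added. So every member without [w] is actually moved: it contains [z] and its
    exchange is not in [F]. *)
Lemma shift_blocked (T : finType) (F : {set {set T}}) w z :
  fixfree F -> ~~ fixfree (shift w z F) ->
  {in F, forall A : {set T}, (w \in A) || (z \in A)} /\
  (forall A : {set T}, A \in F -> z \in A -> w \notin A -> w |: A :\ z \notin F).
Proof.
move=> ntF; rewrite negb_forall => /existsP[v nv].
have all_v A : A \in F -> v \in shift_set w z F A.
  move=> AF; apply: contraR nv => vA; apply/exists_inP.
  by exists (shift_set w z F A) => //; apply: imset_f.
have vw : v = w.
  have [A AF vA] := fixfreeP _ ntF v; have := all_v A AF; rewrite /shift_set.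
  case: ifP => _; last by rewrite (negPf vA).
  by rewrite !inE (negPf vA) andbF orbF => /eqP.
rewrite vw in all_v; split=> [A AF|A AF zA wA]; have := all_v A AF; rewrite /shift_set.
  by case: ifP => [/and3P[-> _ _]|_ ->]; rewrite ?orbT.
by rewrite zA wA /=; case: ifP => // _; rewrite (negPf wA).
Qed.

Lemma maximal_pair (T : finType) (F G : {set {set T}}) k :
  2 <= k -> 2 * k < #|T| -> admissible k F G ->
  (forall F' G' : {set {set T}}, admissible k F' G' -> #|F'| + #|G'| <= #|F| + #|G|) ->
  #|F| + #|G| + 2 * 'C(#|T| - k, k) <= 2 + 'C(#|T|, k) + 'C(#|T| - 2 * k, k) /\
  (3 <= k ->
   #|F| + #|G| + 2 * 'C(#|T| - k, k) = 2 + 'C(#|T|, k) + 'C(#|T| - 2 * k, k) ->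
   #|F| = 2 \/ #|G| = 2).
Proof.
move=> lek lekn adm maxFG.
have [|K /drawsP[_ cK] _] := @exists_draw T set0 setT k.+1 (sub0set _).
  by rewrite cards0 cardsT; move: lek lekn; clear; lia.
(* Both sizes are fixed separately, so that a conclusion on |F'| or |G'| carries back to the given
   pair. *)
pose P (p : {set {set T}} * {set {set T}}) :=
  [&& admissible k p.1 p.2, #|p.1| == #|F| & #|p.2| == #|G|].
have P0 : P (F, G) by rewrite /P adm !eqxx.
have [[F' G'] /and3P[/= adm' /eqP cF /eqP cG] maxW] :=
  exists_argmax (fun p => weight K p.1 + weight K p.2) P0.
rewrite -cF -cG.
have maxF' F'' : admissible k F'' G' -> #|F''| <= #|F'|.
  by move/maxFG; rewrite -cF -cG leq_add2r.
have maxG' G'' : admissible k G'' F' -> #|G''| <= #|G'|.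
  by rewrite admissibleC => /maxFG; rewrite -cF -cG leq_add2l.
have /and5P[sF sG ntF ntG FG] := adm'.
have [h|] := boolP [forall w in K, forall z in ~: K,
    fixfree (shift w z F') && fixfree (shift w z G')].
  have W w z : w \in K -> z \notin K ->
      weight K (shift w z F') + weight K (shift w z G') <= weight K F' + weight K G'.
    move=> wK zK; apply: (maxW (shift w z F', shift w z G')).
    rewrite /P /= !card_shift cF cG !eqxx !andbT.
    have /andP[nF nG] : fixfree (shift w z F') && fixfree (shift w z G').
      by move/forall_inP/(_ w wK)/forall_inP: h; apply; rewrite inE.
    by apply/and5P; split; rewrite ?shift_draws ?inE ?shift_cross.
  have pF : pushed_into K F'.
    move=> A w z AF wK wA zA zK; apply: (shift_weight_eq wK zK _ AF wA zA).
    rewrite -(leq_add2r (weight K G')); apply: leq_trans (W w z wK zK).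
    by rewrite leq_add2l shift_weight.
  have pG : pushed_into K G'.
    move=> A w z AF wK wA zA zK; apply: (shift_weight_eq wK zK _ AF wA zA).
    rewrite -(leq_add2l (weight K F')); apply: leq_trans (W w z wK zK).
    by rewrite leq_add2r shift_weight.
  have le := core_case lek lekn cK adm' pF pG.
  split; first by apply: leq_trans le; apply: leq_addr.
  by move=> lek3 e; move: le; rewrite e lek3 addn1 ltnn.
rewrite negb_forall => /existsP[w]; rewrite negb_imply => /andP[wK].
rewrite negb_forall => /existsP[z]; rewrite negb_imply inE => /andP[zK].
have wz : w != z by apply: contraNneq zK => <-.
rewrite negb_and => /orP[nF|nG].
  have [hit nswap] := shift_blocked ntF nF.
  have [le eq2] := blocked_case lek lekn wz adm' maxF' hit nswap.
  by split=> // lek3 e; left; apply: eq2.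
have [hit nswap] := shift_blocked ntG nG.
rewrite admissibleC in adm'.
have [le eq2] := blocked_case lek lekn wz adm' maxG' hit nswap.
by rewrite [#|F'| + _]addnC; split=> // lek3 e; right; apply: eq2.
Qed.

Lemma admissible_le (T : finType) (F G : {set {set T}}) k :
  2 <= k -> 2 * k < #|T| -> admissible k F G ->
  #|F| + #|G| + 2 * 'C(#|T| - k, k) <= 2 + 'C(#|T|, k) + 'C(#|T| - 2 * k, k).
Proof.
move=> lek lekn adm.
have [[F' G'] /= adm' max] := @exists_argmax _
  (fun p : {set {set T}} * {set {set T}} => admissible k p.1 p.2)
  (fun p => #|p.1| + #|p.2|) (F, G) adm.
have [|le _] := maximal_pair lek lekn adm'; first by move=> F'' G'' /(max (F'', G'')).
by apply: leq_trans le; rewrite leq_add2r; apply: (max (F, G)).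
Qed.

(** By [admissible_le], a pair attaining the bound has maximal total size, so [maximal_pair] applies
    to it. *)
Lemma admissible_eq (T : finType) (F G : {set {set T}}) k :
  3 <= k -> 2 * k < #|T| -> admissible k F G ->
  #|F| + #|G| + 2 * 'C(#|T| - k, k) = 2 + 'C(#|T|, k) + 'C(#|T| - 2 * k, k) ->
  #|F| = 2 \/ #|G| = 2.
Proof.
move=> lek lekn adm e; have lek2 : 2 <= k := ltnW lek.
have [|_] := maximal_pair lek2 lekn adm; last exact.
move=> F' G' /(admissible_le lek2 lekn).
by rewrite -e leq_add2r.
Qed.

(** * Translation to the definitions of the statement *)

Lemma uniform_familyE (n k : nat) (F : {set {set 'I_n}}) :
  uniform_family k F <-> F \subset draws setT k.
Proof.
split=> [h|/subsetP h A AF]; last by have /drawsP[] := h A AF.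
by apply/subsetP => A AF; apply/drawsP; split; [exact: subsetT | exact: h].
Qed.

Lemma nontrivialE (n : nat) (F : {set {set 'I_n}}) :
  0 < n -> nontrivial F <-> fixfree F.
Proof.
move=> n_gt0; split=> [[_ /setP cap0]|/fixfreeP h].
  apply/fixfreeP => v; apply/exists_inP; have := cap0 v; rewrite inE => /negbT.
  by apply: contraR => /exists_inPn h; apply/bigcapP => A /h; rewrite negbK.
split.
  by have [A AF _] := h (Ordinal n_gt0); apply/set0Pn; exists A.
apply/setP => v; rewrite inE; apply/negP => /bigcapP hv.
by have [A /hv vA] := h v; rewrite vA.
Qed.

Lemma admissible_pairE (n k : nat) (F G : {set {set 'I_n}}) :
  0 < n -> admissible_pair k F G <-> admissible k F G.
Proof.
move=> n_gt0; split.
  case=> /uniform_familyE uF /uniform_familyE uG /nontrivialE nF /nontrivialE nG FG.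
  by apply/and5P; split; [| | exact: nF | exact: nG | exact/crossP].
case/and5P=> uF uG nF nG /crossP FG.
by split=> //; [exact/uniform_familyE | exact/uniform_familyE
  | exact/nontrivialE | exact/nontrivialE].
Qed.

Lemma both_meetingE (n k : nat) (A1 A2 : {set 'I_n}) :
  both_meeting k A1 A2 = meeting2 setT A1 A2 k.
Proof. by apply/setP => B; rewrite !inE subsetT. Qed.

Lemma h_formulaE (n k s : nat) :
  (s%:Z = h_formula n k)%R <->
  s + 2 * 'C(n - k, k) = 2 + 'C(n, k) + 'C(n - 2 * k, k).
Proof. by rewrite /h_formula; lia. Qed.

Lemma h_formula_le (n k s : nat) :
  (s%:Z <= h_formula n k)%R <->
  s + 2 * 'C(n - k, k) <= 2 + 'C(n, k) + 'C(n - 2 * k, k).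
Proof. by rewrite /h_formula; lia. Qed.

Lemma card_meeting2_pair (n k : nat) (A1 A2 : {set 'I_n}) :
  #|A1| = k -> #|A2| = k -> A1 :&: A2 = set0 ->
  2 + #|meeting2 setT A1 A2 k| + 2 * 'C(n - k, k) =
  2 + 'C(n, k) + 'C(n - 2 * k, k).
Proof.
move=> c1 c2 /eqP; rewrite setI_eq0 => d12.
have := card_draws_meeting2 k (subsetT A1) (subsetT A2) d12.
rewrite -/(meeting2 setT A1 A2 k) c1 c2 cardsT card_ord addnn -mul2n.
by move: #|meeting2 _ _ _ _|; clear; lia.
Qed.

(** Two members without a common point are disjoint. Cross-intersection puts [G] inside
    [both_meeting], and the total size forces equality. *)
Lemma two_members_extremal (n k : nat) (F G : {set {set 'I_n}}) :
  admissible k F G -> #|F| = 2 ->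
  #|F| + #|G| + 2 * 'C(n - k, k) = 2 + 'C(n, k) + 'C(n - 2 * k, k) ->
  exists A1 A2 : {set 'I_n}, [/\ #|A1| = k, #|A2| = k, A1 :&: A2 = set0 &
    F = [set A1; A2] /\ G = both_meeting k A1 A2].
Proof.
move=> /and5P[sF sG /fixfreeP ntF _ /crossP FG] c2 e.
have /eqP/cards2P[A1 [A2 [_ eF]]] := c2.
have F1 : A1 \in F by rewrite eF !inE eqxx.
have F2 : A2 \in F by rewrite eF !inE eqxx orbT.
have /drawsP[_ c1] := subsetP sF _ F1; have /drawsP[_ c2'] := subsetP sF _ F2.
have d12 : A1 :&: A2 = set0.
  apply/setP => v; rewrite !inE; apply/negP => /andP[v1 v2].
  by have [A] := ntF v; rewrite eF !inE => /orP[/eqP->|/eqP->]; rewrite ?v1 ?v2.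
exists A1, A2; split=> //; split=> //; rewrite both_meetingE.
apply/eqP; rewrite eqEcard; apply/andP; split.
  apply/subsetP => B BG; rewrite inE (subsetP sG) //= ![B :&: _]setIC.
  by rewrite !FG.
have := card_meeting2_pair c1 c2' d12.
have arith a b c d : 2 + b + c = d -> 2 + a + c = d -> b <= a by lia.
by move=> /arith; apply; rewrite -e c2.
Qed.

Theorem theorem1p5 (n k : nat) (hk : 2 <= k) (hn : 2 * k < n) :
  (* h(n,k) equals the formula: upper bound ... *)
  [/\ (forall F G : {set {set 'I_n}}, admissible_pair k F G ->
         ((#|F| + #|G|)%:Z <= h_formula n k)%R),
  (* ... attained ... *)
      (exists F G : {set {set 'I_n}}, admissible_pair k F G /\
         ((#|F| + #|G|)%:Z)%R = h_formula n k)
  (* ... and, for k >= 3, uniquely by the pair ({A1,A2}, B(A1,A2)) up to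
     permutation of [n] (absorbed by the choice of A1, A2) and swapping *)
    & (3 <= k -> forall F G : {set {set 'I_n}}, admissible_pair k F G ->
         ((#|F| + #|G|)%:Z)%R = h_formula n k ->
         exists A1 A2 : {set 'I_n},
           [/\ #|A1| = k, #|A2| = k, A1 :&: A2 = set0 &
             (F = [set A1; A2] /\ G = both_meeting k A1 A2) \/
             (G = [set A1; A2] /\ F = both_meeting k A1 A2)])].
Proof.
have n_gt0 : 0 < n by lia.
have hT : 2 * k < #|'I_n| by rewrite card_ord.
split.
- move=> F G /(admissible_pairE _ _ _ n_gt0) adm; apply/h_formula_le.
  by have := admissible_le hk hT adm; rewrite card_ord.
- have [|A1 /drawsP[_ c1] _] := @exists_draw 'I_n set0 setT k (sub0set _).
    by rewrite cards0 cardsT card_ord; lia.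
  have [|A2 /drawsP[s2 c2] _] := @exists_draw 'I_n set0 (~: A1) k (sub0set _).
    by rewrite cards0 cardsCs setCK card_ord c1; lia.
  have d12 : A1 :&: A2 = set0.
    by rewrite setIC; apply: disjoint_setI0; rewrite disjoints_subset.
  have A12 : A1 != A2.
    apply/eqP => e; move: d12; rewrite -e setIid => A10.
    by move: c1; rewrite A10 cards0; move: hk; clear; lia.
  exists [set A1; A2], (meeting2 setT A1 A2 k); split; last first.
    apply/h_formulaE; rewrite cards2 A12; exact: card_meeting2_pair.
  apply/(admissible_pairE _ _ _ n_gt0)/and5P; split.
  + apply/subsetP => A; rewrite !inE subsetT => /orP[/eqP->|/eqP->].
      by rewrite c1 eqxx.
    by rewrite c2 eqxx.
  + by apply/subsetP => B /setIdP[].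
  + apply/fixfreeP => v; have [v1|v1] := boolP (v \in A1).
      exists A2; first by rewrite !inE eqxx orbT.
      by apply/negP => v2; have := in_setI v A1 A2; rewrite d12 v1 v2 inE.
    by exists A1; rewrite // !inE eqxx.
  + apply/fixfreeP => v.
    (* As k >= 2, both [A1] and [A2] have a point other than [v]; a [k]-set through two such points
       can avoid [v]. *)
    have other (A : {set 'I_n}) : #|A| = k -> exists2 x, x \in A & x != v.
      move=> cA; have /card_gt0P[x] : 0 < #|A :\ v|.
        have := cardsD1 v A; rewrite cA; case: (v \in A); move: hk; clear; lia.
      by rewrite !inE => /andP[xv xA]; exists x.
    have [p p1 pv] := other _ c1; have [q q2 qv] := other _ c2.
    have [||B /drawsP[sB cB]] := @exists_draw _ [set p; q] (~: [set v]) k.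
    * by rewrite subUset !sub1set !inE pv qv.
    * rewrite cards2 cardsCs setCK card_ord cards1; move: hk hn; clear.
      by case: (_ != _); lia.
    rewrite subUset !sub1set => /andP[pB qB]; exists B; last first.
      by apply/negP => /(subsetP sB); rewrite !inE eqxx.
    rewrite !inE subsetT cB eqxx /=.
    by apply/andP; split; apply/set0Pn; [exists p|exists q]; rewrite inE ?pB ?qB.
  + apply/crossP => A B; rewrite !inE => /orP[] /eqP -> /and3P[_ h1 h2];
      by rewrite setIC.
move=> hk3 F G /(admissible_pairE _ _ _ n_gt0) adm /h_formulaE e.
have e' : #|F| + #|G| + 2 * 'C(#|'I_n| - k, k) =
    2 + 'C(#|'I_n|, k) + 'C(#|'I_n| - 2 * k, k) by rewrite card_ord.
have [c2|c2] := admissible_eq hk3 hT adm e'.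
  have [A1 [A2 [h1 h2 h3 h4]]] := two_members_extremal adm c2 e.
  by exists A1, A2; split=> //; left.
rewrite admissibleC in adm; rewrite [#|F| + _]addnC in e.
have [A1 [A2 [h1 h2 h3 h4]]] := two_members_extremal adm c2 e.
by exists A1, A2; split=> //; right.
Qed.
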